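(* Let $a=(a_n)_{n\in\mathbb Z}\in\ell^\infty(\mathbb Z,\mathbb C)$ and $b=(b_n)_{n\in\mathbb Z}\in\ell^\infty(\mathbb Z,\mathbb R)$ (it is allowed that $a_n=0$ for some $n$), let $J_{a,b}$ be the associated Jacobi operator on $\ell^2(\mathbb Z)$, and for $E\in\mathbb C$ let $B^E:\mathbb Z\to \mathrm M(2,\mathbb C)$ be the associated Jacobi cocycle map. Then the resolvent set $\rho(J_{a,b})=\mathbb C\setminus\sigma(J_{a,b})$ satisfies $$\rho(J_{a,b})=\{E\in\mathbb C:\ B^E \text{ admits dominated splitting}\}.$$
   Context: The Jacobi operator $J_{a,b}:\ell^2(\mathbb Z)\to\ell^2(\mathbb Z)$ is $(J_{a,b}\psi)(n)=\overline{a_{n-1}}\psi(n-1)+a_n\psi(n+1)+b_n\psi(n)$. The Jacobi cocycle map is $B^E(j)=\begin{pmatrix}E-b_j & -\overline{a_{j-1}}\\ a_j & 0\end{pmatrix}$, $j\in\mathbb Z$. $\mathrm M(2,\mathbb C)$ is the set of complex $2\times2$ matrices and $\mathbb Z_+$ the positive integers. For $B:\mathbb Z\to \mathrm M(2,\mathbb C)$ and $n\ge1$ put $B_n(j)=B(j+n-1)\cdots B(j)$. For one-dimensional subspaces $V,W$ of $\mathbb C^2$ put $d(V,W)=\frac{2|\det(\vec v,\vec w)|}{\|\vec v\|\,\|\vec w\|}$ for any nonzero $\vec v\in V$, $\vec w\in W$. Definition. A sequence $B\in\ell^\infty(\mathbb Z,\mathrm M(2,\mathbb C))$ admits dominated splitting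 if for each $j\in\mathbb Z$ there are one-dimensional subspaces $E^u(j),E^s(j)$ of $\mathbb C^2$ such that: (1) $B(j)[E^u(j)]\subseteq E^u(j+1)$ and $B(j)[E^s(j)]\subseteq E^s(j+1)$ for all $j\in\mathbb Z$; (2) there exist $N\in\mathbb Z_+$ and $\lambda>1$ such that $\|B_N(j)\vec u\|>\lambda\|B_N(j)\vec s\|$ for all $j\in\mathbb Z$ and all unit vectors $\vec u\in E^u(j)$, $\vec s\in E^s(j)$; (3) there exists $\delta>0$ such that $d(E^u(j),E^s(j))>\delta$ for all $j\in\mathbb Z$; (4) for the $N$ of condition (2), $\inf_{j\in\mathbb Z}\|B_N(j)\|>0$. *)

(* Defs.v *)
(* The complex numbers are [R[i]] for an arbitrary [R : realType]. *)
From HB Require Import structures.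
From mathcomp Require Import all_boot all_order all_algebra.
From mathcomp Require Import complex.
From mathcomp Require Import ring.
From mathcomp Require Import all_classical all_reals all_analysis.

Set Implicit Arguments.
Unset Strict Implicit.
Unset Printing Implicit Defensive.

Import Order.TTheory GRing.Theory Num.Theory.
Import ComplexField.Normc.
Import numFieldNormedType.Exports.

Local Open Scope classical_set_scope.
Local Open Scope ring_scope.
Local Open Scope complex_scope.

Section spectrum.
Context {K : numFieldType} {V : normedModType K}.

Definition boundedly_invertible (T : V -> V) : Prop :=
  exists G : {linear V -> V}, [/\ continuous G, cancel T G & cancel G T].

Definition spectrum (T : {linear V -> V}) : set K :=
  [set E | ~ boundedly_invertible (fun v => T v - E *: v)].

Definition resolvent_set (T : {linear V -> V}) : set K := ~` spectrum T.

End spectrum.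

Section l2.
Context {R : realType}.
Implicit Types (f g : int -> R[i]).

Definition sqsum f : \bar R := (\esum_(n in [set: int]) (normc (f n) ^+ 2)%:E)%E.

Definition square_summable : {pred int -> R[i]} :=
  fun f => `[< (sqsum f < +oo)%E >].

Definition seqnorm f : R := Num.sqrt (fine (sqsum f)).

Lemma normc_ge0 (z : R[i]) : 0 <= normc z.
Proof. by case: z => x y; exact: sqrtr_ge0. Qed.

Lemma sqsum_ge0 f : (0 <= sqsum f)%E.
Proof. by apply: esum_ge0 => n _; rewrite lee_fin sqr_ge0. Qed.

Lemma square_summableE f : f \in square_summable -> sqsum f \is a fin_num.
Proof. by move/asboolP => h; rewrite ge0_fin_numE ?sqsum_ge0. Qed.

Lemma seqnorm_ge0 f : 0 <= seqnorm f.
Proof. exact: sqrtr_ge0. Qed.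

Lemma sqr_seqnorm f : f \in square_summable ->
  (seqnorm f ^+ 2)%:E = sqsum f.
Proof.
move=> hf; rewrite sqr_sqrtr ?fineK ?square_summableE //.
by rewrite fine_ge0// sqsum_ge0.
Qed.

Lemma sqsum_leP f (M : R) :
  reflect (forall s : seq int, uniq s -> \sum_(n <- s) normc (f n) ^+ 2 <= M)
          (sqsum f <= M%:E)%E.
Proof.
apply: (iffP idP) => [h s us|h].
  rewrite -lee_fin; apply: le_trans h; rewrite -sumEFin.
  apply: ereal_sup_ubound => /=.
  by exists [set` s]; [split => //; exact: finite_seq|rewrite -fsbig_seq].
apply: ge_ereal_sup => _ [F [fF _] <-].
by rewrite fsbig_finite//= sumEFin lee_fin; apply: h; exact: finmap.fset_uniq.
Qed.

Lemma square_summableI f M : (sqsum f <= M%:E)%E -> f \in square_summable.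
Proof. by move=> h; apply/asboolP; rewrite (le_lt_trans h)// ltry. Qed.

Lemma seqnorm_le f M : 0 <= M -> (sqsum f <= (M ^+ 2)%:E)%E -> seqnorm f <= M.
Proof.
move=> M0 h; rewrite -(ler_pXn2r (_ : 0 < 2)%N) ?nnegrE ?seqnorm_ge0//.
by rewrite -lee_fin sqr_seqnorm//; exact: square_summableI h.
Qed.

Lemma seqnorm_sum f (s : seq int) : f \in square_summable -> uniq s ->
  \sum_(n <- s) normc (f n) ^+ 2 <= seqnorm f ^+ 2.
Proof. by move=> hf; apply/sqsum_leP; rewrite sqr_seqnorm. Qed.

Lemma seqnorm0_eq0 f : f \in square_summable -> seqnorm f = 0 -> f = 0.
Proof.
move=> hf f0; apply/funext => n; apply: eq0_normc; apply/eqP.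
have := seqnorm_sum (s := [:: n]) hf erefl.
rewrite f0 expr0n/= big_seq1 => h.
by rewrite -sqrf_eq0 eq_le h sqr_ge0.
Qed.

Lemma sqsumD f g : f \in square_summable -> g \in square_summable ->
  (sqsum (f + g)%R <= ((seqnorm f + seqnorm g) ^+ 2)%:E)%E.
Proof.
move=> hf hg; have [f0|f_neq0] := eqVneq (seqnorm f) 0.
  by rewrite f0 (seqnorm0_eq0 hf f0) !add0r sqr_seqnorm.
have [g0|g_neq0] := eqVneq (seqnorm g) 0.
  by rewrite g0 (seqnorm0_eq0 hg g0) !addr0 sqr_seqnorm.
set A := seqnorm f in f_neq0 *; set B := seqnorm g in g_neq0 *.
have A0 : 0 < A by rewrite lt_neqAle eq_sym f_neq0 seqnorm_ge0.
have B0 : 0 < B by rewrite lt_neqAle eq_sym g_neq0 seqnorm_ge0.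
apply/sqsum_leP => s us.
have -> : (A + B) ^+ 2 = (1 + B / A) * A ^+ 2 + (1 + A / B) * B ^+ 2.
  by field; rewrite f_neq0 g_neq0.
apply: (@le_trans _ _ (\sum_(n <- s) ((1 + B / A) * normc (f n) ^+ 2 +
                                      (1 + A / B) * normc (g n) ^+ 2))).
  apply: ler_sum => n _; set x := normc (f n); set y := normc (g n).
  apply: (@le_trans _ _ ((x + y) ^+ 2)).
    rewrite ler_pXn2r ?nnegrE ?addr_ge0 ?normc_ge0//; exact: le_normcD.
  rewrite -subr_ge0.
  have -> : (1 + B / A) * x ^+ 2 + (1 + A / B) * y ^+ 2 - (x + y) ^+ 2 =
            (B * x - A * y) ^+ 2 / (A * B).
    by field; rewrite f_neq0 g_neq0.
  by rewrite divr_ge0 ?sqr_ge0 ?mulr_ge0 ?ltW.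
rewrite big_split/= -!mulr_sumr.
by rewrite lerD// ler_wpM2l ?seqnorm_sum ?addr_ge0 ?divr_ge0 ?ltW.
Qed.

Lemma sqsum_bounded f g (M : R) : (forall n, normc (f n) <= M) ->
  g \in square_summable ->
  (sqsum (fun n => f n * g n)%R <= ((M * seqnorm g) ^+ 2)%:E)%E.
Proof.
move=> fM hg; apply/sqsum_leP => s us; rewrite exprMn.
apply: (@le_trans _ _ (\sum_(n <- s) M ^+ 2 * normc (g n) ^+ 2)).
  apply: ler_sum => n _; rewrite normcM exprMn ler_wpM2r ?sqr_ge0//.
  by rewrite ler_pXn2r ?nnegrE ?normc_ge0// (le_trans (normc_ge0 (f n))).
by rewrite -mulr_sumr ler_wpM2l ?sqr_ge0// seqnorm_sum.
Qed.

Lemma square_summable_submod_closed : submod_closed square_summable.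
Proof.
split => [|c f g hf hg].
  apply: (@square_summableI _ 0); apply/sqsum_leP => s _.
  by rewrite big1// => n _; rewrite [normc _]normc0 expr0n.
apply: (square_summableI (sqsumD _ hg)).
by apply: (square_summableI (sqsum_bounded (f := cst c) (fun=> lexx _) hf)).
Qed.

HB.instance Definition _ :=
  GRing.isSubmodClosed.Build R[i] (int -> R[i]) square_summable
    square_summable_submod_closed.

End l2.

Record l2 (R : realType) := L2 {
  l2val :> int -> R[i];
  l2valP : l2val \in square_summable }.

HB.instance Definition _ (R : realType) := [isSub for @l2val R].
HB.instance Definition _ (R : realType) := [Choice of l2 R by <:].
HB.instance Definition _ (R : realType) := [SubChoice_isSubLmodule of l2 R by <:].

Section l2_norm.
Context {R : realType}.
Implicit Types (psi phi : l2 R).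

(* A norm over the scalar field [R[i]] takes its values in [R[i]]. *)
Definition l2norm psi : R[i] := (seqnorm psi)%:C.

Lemma ler_l2normD psi phi : l2norm (psi + phi) <= l2norm psi + l2norm phi.
Proof.
rewrite -rmorphD/= lecR seqnorm_le ?addr_ge0 ?seqnorm_ge0//.
by apply: sqsumD; exact: l2valP.
Qed.

Lemma l2normZ (c : R[i]) psi : l2norm (c *: psi) = `|c| * l2norm psi.
Proof.
have le k (f : int -> R[i]) : f \in square_summable ->
    seqnorm (k *: f) <= normc k * seqnorm f.
  move=> hf; apply: seqnorm_le; first by rewrite mulr_ge0 ?normc_ge0 ?seqnorm_ge0.
  exact: (sqsum_bounded (f := cst k) (fun=> lexx _) hf).
have hpsi := l2valP psi; have hc := l2valP (c *: psi).
have [->|c0] := eqVneq c 0.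
  rewrite scale0r normr0 mul0r /l2norm.
  suff -> : seqnorm (0 : l2 R) = 0 by [].
  apply/eqP; rewrite eq_le seqnorm_ge0 andbT.
  by have := le 0 _ hpsi; rewrite scale0r normc0 mul0r.
have -> : `|c| = (normc c)%:C by [].
rewrite -rmorphM; congr (_%:C); apply/eqP; rewrite eq_le le//=.
have nc : 0 < normc c.
  by rewrite lt_neqAle normc_ge0 andbT eq_sym; apply: contra c0 => /eqP/eq0_normc ->.
rewrite -ler_pdivlMl// -normcV.
have := le c^-1 _ hc; congr (seqnorm _ <= _).
by rewrite [RHS](_ : _ = c^-1 *: (c *: l2val psi)) ?scalerA ?mulVf ?scale1r.
Qed.

Lemma l2norm0_eq0 psi : l2norm psi = 0 -> psi = 0.
Proof.
by move=> [h]; apply: val_inj; rewrite /= (seqnorm0_eq0 (l2valP psi) h).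
Qed.

HB.instance Definition _ := Lmodule_isNormed.Build R[i] (l2 R)
  ler_l2normD l2normZ l2norm0_eq0.

End l2_norm.

Section jacobi.
Context {R : realType}.
Context (a : int -> R[i]) (b : int -> R).

Definition jacobi_fun (f : int -> R[i]) : int -> R[i] := fun n =>
  (a (n - 1))^* * f (n - 1) + a n * f (n + 1) + (b n)%:C * f n.

Context (ha : bounded_fun (a : int -> R[i]^o)) (hb : bounded_fun (b : int -> R^o)).

Lemma bounded_normc (c : int -> R[i]) : bounded_fun (c : int -> R[i]^o) ->
  exists M, forall n, normc (c n) <= M.
Proof.
case=> M [_ hM]; exists (complex.Re (M + 1)) => n.
have : (normc (c n))%:C <= M + 1 := hM _ (ltr_pwDr ltr01 (lexx M)) n I.
by rewrite lecE => /andP[].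
Qed.

Lemma square_summable_bounded (c f : int -> R[i]) (M : R) :
  (forall n, normc (c n) <= M) -> f \in square_summable ->
  (fun n => c n * f n) \in square_summable.
Proof. by move=> hM hf; apply: square_summableI (sqsum_bounded hM hf). Qed.

Lemma square_summable_shift (k : int) (f : int -> R[i]) :
  f \in square_summable -> (fun n => f (n + k)) \in square_summable.
Proof.
move=> hf; apply: (@square_summableI _ _ (seqnorm f ^+ 2)); apply/sqsum_leP => s us.
rewrite -(big_map (fun n => n + k) xpredT (fun n => normc (f n) ^+ 2)).
by apply: seqnorm_sum; rewrite // map_inj_uniq//; exact: addIr.
Qed.

Lemma jacobi_fun_l2 (psi : l2 R) : jacobi_fun psi \in square_summable.
Proof.
have hpsi := l2valP psi.
have [Ma hMa] := bounded_normc ha.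
have [Mb hMb] : exists M, forall n, normc (b n)%:C <= M.
  case: hb => M [_ hM]; exists (M + 1) => n.
  by rewrite /= expr0n addr0 sqrtr_sqr; exact: hM (ltr_pwDr ltr01 (lexx M)) n I.
rewrite (_ : jacobi_fun psi = ((fun n => (a (n - 1))^* * psi (n - 1)) +
  (fun n => a n * psi (n + 1))) + (fun n => (b n)%:C * psi n))//.
rewrite !rpredD//; last exact: square_summable_bounded hMb hpsi.
- apply: (@square_summable_bounded _ (fun n => psi (n - 1)) Ma).
    move=> n; rewrite (_ : normc _ = normc (a (n - 1)))//.
    by case: (a _) => x y /=; rewrite sqrrN.
  exact: square_summable_shift.
- exact: (square_summable_bounded hMa (square_summable_shift 1 hpsi)).
Qed.

Definition jacobi (psi : l2 R) : l2 R := L2 (jacobi_fun_l2 psi).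

Lemma jacobi_linear : linear jacobi.
Proof.
move=> c psi phi; apply: val_inj; apply/funext => n.
set x := l2val psi; set y := l2val phi.
change (jacobi_fun (fun m => c * x m + y m) n =
        c * jacobi_fun x n + jacobi_fun y n).
by rewrite /jacobi_fun; ring.
Qed.

HB.instance Definition _ :=
  GRing.isLinear.Build R[i] (l2 R) (l2 R) *:%R jacobi jacobi_linear.

End jacobi.

Section matrices.
Context {R : realType}.
Implicit Types (v w : 'cV[R[i]]_2) (A : 'M[R[i]]_2).

(* the Euclidean norm of $\mathbb C^2$; [`|v|] would be the sup norm *)
Definition enorm v : R := Num.sqrt (\sum_i normc (v i 0) ^+ 2).

Definition opnorm A : R := sup [set enorm (A *m v) | v in [set v | enorm v = 1]].

Definition vec_dist v w : R :=
  2 * normc (\det (row_mx v w : 'M[R[i]]_2)) / (enorm v * enorm w).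

(* [vpick V] is a nonzero vector of [V] when [V] is nonzero; see [line_distE]
   for the independence of the choice. *)
Definition line_dist (V W : {vspace 'cV[R[i]]_2}) : R :=
  vec_dist (vpick V) (vpick W).

Lemma enormZ (k : R[i]) v : enorm (k *: v) = normc k * enorm v.
Proof.
rewrite /enorm (eq_bigr (fun i => normc k ^+ 2 * normc (v i 0) ^+ 2)).
  by rewrite -mulr_sumr sqrtrM ?sqr_ge0// sqrtr_sqr ger0_norm ?normc_ge0.
by move=> i _; rewrite mxE normcM exprMn.
Qed.

Lemma vec_distZ (k l : R[i]) v w : k != 0 -> l != 0 ->
  vec_dist (k *: v) (l *: w) = vec_dist v w.
Proof.
move=> k0 l0; rewrite /vec_dist !enormZ.
have -> : \det (row_mx (k *: v) (l *: w) : 'M[R[i]]_2) =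
          k * l * \det (row_mx v w : 'M[R[i]]_2).
  have -> : (row_mx (k *: v) (l *: w) : 'M[R[i]]_2) =
            row_mx v w *m (block_mx k%:M 0 0 l%:M : 'M[R[i]]_(1 + 1)).
    by rewrite mul_row_block !mulmx0 addr0 add0r !mul_mx_scalar.
  by rewrite det_mulmx (@det_ublock _ 1 1 k%:M 0 l%:M) !det_scalar1 mulrC.
have nk : normc k != 0 by apply: contra k0 => /eqP/eq0_normc ->.
have nl : normc l != 0 by apply: contra l0 => /eqP/eq0_normc ->.
rewrite !normcM mulrACA [2 * _]mulrCA; rewrite -[RHS]mul1r.
by rewrite invfM mulrACA divff ?mulf_neq0.
Qed.

Lemma line_distE (V W : {vspace 'cV[R[i]]_2}) v w :
  \dim V = 1%N -> \dim W = 1%N -> v \in V -> v != 0 -> w \in W -> w != 0 ->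
  line_dist V W = vec_dist v w.
Proof.
have pickE (U : {vspace 'cV[R[i]]_2}) u : \dim U = 1%N -> u \in U -> u != 0 ->
    exists2 k, k != 0 & vpick U = k *: u.
  move=> dU uU u0.
  have UE : (<[u]> = U)%VS.
    by apply/eqP; rewrite eqEdim -memvE uU dU dim_vline u0.
  have: vpick U \in <[u]>%VS by rewrite UE memv_pick.
  case/vlineP => k kE; exists k => //; apply/eqP => k0; move: kE dU.
  by rewrite k0 scale0r => /eqP; rewrite vpick0 => /eqP ->; rewrite dimv0.
move=> dV dW vV v0 wW w0; rewrite /line_dist.
have [k k0 ->] := pickE V v dV vV v0.
have [l l0 ->] := pickE W w dW wW w0.
exact: vec_distZ.
Qed.

(* $B_n(j) = B(j+n-1)\cdots B(j)$ *)
Fixpoint iter_cocycle (B : int -> 'M[R[i]]_2) (n : nat) (j : int) : 'M[R[i]]_2 :=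
  if n is m.+1 then B (j + m%:Z) *m iter_cocycle B m j else 1%:M.

(* The same [N] serves in the domination and in the norm lower bound. *)
Definition dominated_splitting (B : int -> 'M[R[i]]_2) : Prop :=
  bounded_fun B /\
  exists Eu Es : int -> {vspace 'cV[R[i]]_2},
    (forall j, \dim (Eu j) = 1%N /\ \dim (Es j) = 1%N) /\
    exists (N : nat) (lambda delta : R),
    [/\ (0 < N)%N, 1 < lambda & 0 < delta] /\
    [/\ forall j,
          (forall v, v \in Eu j -> B j *m v \in Eu (j + 1)) /\
          (forall v, v \in Es j -> B j *m v \in Es (j + 1)),
        forall j u s, u \in Eu j -> s \in Es j -> enorm u = 1 -> enorm s = 1 ->
          enorm (iter_cocycle B N j *m u) > lambda * enorm (iter_cocycle B N j *m s),
        forall j, line_dist (Eu j) (Es j) > delta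
      & 0 < inf (range (fun j => opnorm (iter_cocycle B N j)))].

Definition jacobi_cocycle (a : int -> R[i]) (b : int -> R) (E : R[i]) (j : int) :
    'M[R[i]]_2 :=
  \matrix_(i < 2, k < 2)
    if i == 0 then (if k == 0 then E - (b j)%:C else - (a (j - 1))^*)
    else (if k == 0 then a j else 0).

End matrices.

(* Main.v *)
(* Write [T = J - E] and let [B] be the Jacobi cocycle; [B(j)] maps
   [(psi j, psi (j - 1))] to [a_j (psi (j + 1), psi j)] when [T psi] vanishes
   at [j].

   Splitting implies invertibility. With unit vectors [u_j = (p, q)] and
   [s_j = (r, t)] of the two bundles, [B(j) u_j = mu_j u_{j+1}],
   [B(j) s_j = nu_j s_{j+1}] and [D_j = det (u_j, s_j)], expanding
   [(psi j, psi (j - 1))] in the frame turns [T psi = f] into the two scalar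
   first order recursions
     [X_j = (a_j / mu_j) X_{j+1} - t_{j+1} / (mu_j D_{j+1}) f_j],
     [W_j = (conj a_{j-1} / mu_j) W_{j-1} - (p_j / mu_j) f_j],
   with [psi j = X_j p_j + W_{j-1} r_j / D_j]. No division by [a_j] occurs, so
   zeros of [a] are harmless. Since
   [mu_j nu_j D_{j+1} = a_j conj a_{j-1} D_j], domination makes long products
   of the coefficients uniformly small, and a Neumann series solves both
   recursions in [l^2].

   Invertibility implies splitting. [E^u(j)] and [E^s(j)] are the data at [j]
   of square summable solutions on the half lines left and right of [j]. A
   solution cut off at [k] is mapped by [T] to a vector supported on two
   sites, so the bound [|psi| <= K |T psi|] controls its tail by its values at
   [k] and [k - 1]; averaging over [k] gives decay, hence domination. The same
   bound gives the transversality and the expansion on [E^u], surjectivity of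
   [T] gives [E^u(j) + E^s(j) = C^2], and the Wronskian, of constant weighted
   modulus, excludes two-dimensional bundles. *)

Require Import Defs.
From HB Require Import structures.
From mathcomp Require Import all_boot all_order all_algebra.
From mathcomp Require Import complex.
From mathcomp Require Import ring lra zify.
From mathcomp Require Import all_classical all_reals all_analysis.

Set Implicit Arguments.
Unset Strict Implicit.
Unset Printing Implicit Defensive.

Import Order.TTheory GRing.Theory Num.Theory.
Import ComplexField.Normc.
Import numFieldNormedType.Exports.

Local Open Scope classical_set_scope.
Local Open Scope ring_scope.
Local Open Scope complex_scope.

(** * Square summable sequences *)

Section complex_modulus.
Context {R : rcfType}.
Implicit Types z w : R[i].

Lemma normc_nneg z : 0 <= normc z.
Proof. by case: z => x y; exact: sqrtr_ge0. Qed.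

Lemma normc_conj z : normc z^* = normc z.
Proof. by case: z => x y; rewrite /= sqrrN. Qed.

Lemma normc_sqr z : ((normc z ^+ 2)%:C : R[i]) = z * z^*.
Proof. by rewrite -sqr_normc rmorphXn. Qed.

Lemma normc_eq0 z : (normc z == 0) = (z == 0).
Proof.
by apply/eqP/eqP => [/eq0_normc//|->]; exact: normc0.
Qed.

Lemma normc_gt0 z : (0 < normc z) = (z != 0).
Proof. by rewrite lt_neqAle normc_nneg andbT eq_sym normc_eq0. Qed.

Lemma le_normcB z w : normc (z - w) <= normc z + normc w.
Proof. by rewrite -(normcN w); exact: le_normcD. Qed.

Lemma normc_real (x : R) : normc (x%:C) = `|x|.
Proof. by rewrite /= expr0n addr0 sqrtr_sqr. Qed.

Lemma normc_prod (I : Type) (s : seq I) (F : I -> R[i]) :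
  normc (\prod_(i <- s) F i) = \prod_(i <- s) normc (F i).
Proof. exact: (big_morph _ (@normcM R) (@normc1 R)). Qed.

End complex_modulus.

Section l2_space.
Context {R : realType}.
Implicit Types (psi phi : l2 R) (c : int -> R[i]).

Lemma l2_eqP psi phi : (forall n, psi n = phi n) -> psi = phi.
Proof. by move=> h; apply: val_inj; apply/funext. Qed.

Lemma l2_addE psi phi n : (psi + phi) n = psi n + phi n. Proof. by []. Qed.
Lemma l2_subE psi phi n : (psi - phi) n = psi n - phi n. Proof. by []. Qed.
Lemma l2_scaleE k psi n : (k *: psi) n = k * psi n. Proof. by []. Qed.
Lemma l2_0E n : (0 : l2 R) n = 0. Proof. by []. Qed.

Lemma seqnormD psi phi : seqnorm (psi + phi) <= seqnorm psi + seqnorm phi.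
Proof. by have := ler_l2normD psi phi; rewrite /l2norm -rmorphD lecR. Qed.

Lemma seqnormZ k psi : seqnorm (k *: psi) = normc k * seqnorm psi.
Proof.
have := l2normZ k psi; rewrite /l2norm.
have -> : `|k| = (normc k)%:C by [].
by rewrite -rmorphM => /complexI.
Qed.

Lemma seqnormN psi : seqnorm (- psi) = seqnorm psi.
Proof. by rewrite -scaleN1r seqnormZ normcN normc1 mul1r. Qed.

Lemma seqnorm_eq0 psi : seqnorm psi = 0 -> psi = 0.
Proof. by move=> h; apply: l2norm0_eq0; rewrite /l2norm h. Qed.

Lemma normc_le_seqnorm psi n : normc (psi n) <= seqnorm psi.
Proof.
rewrite -(ler_pXn2r (_ : 0 < 2)%N) ?nnegrE ?seqnorm_ge0 ?normc_ge0//.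
by have := seqnorm_sum (s := [:: n]) (l2valP psi) erefl; rewrite big_seq1.
Qed.

Lemma seqnorm_leP psi (M : R) : 0 <= M ->
  (forall s : seq int, uniq s -> \sum_(n <- s) normc (psi n) ^+ 2 <= M ^+ 2) ->
  seqnorm psi <= M.
Proof. by move=> M0 h; apply: seqnorm_le => //; apply/sqsum_leP. Qed.

(** Multiplications, shifts and cutoffs are all instances, so this one estimate supplies the square
    summability of the sequences built from a given vector below. *)
Lemma exists_wshift c (M : R) (k : int) psi : (forall n, normc (c n) <= M) ->
  exists phi : l2 R, (forall n, phi n = c n * psi (n + k)) /\
                     seqnorm phi <= M * seqnorm psi.
Proof.
move=> cM; have M0 : 0 <= M by rewrite (le_trans _ (cM 0))// normc_ge0.
have hs := square_summable_shift k (l2valP psi).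
exists (L2 (square_summable_bounded cM hs)); split => //.
apply: seqnorm_leP => [|s us]; first by rewrite mulr_ge0// seqnorm_ge0.
apply: (@le_trans _ _ (\sum_(n <- s) M ^+ 2 * normc (psi (n + k)) ^+ 2)).
  apply: ler_sum => n _ /=; rewrite normcM exprMn ler_wpM2r ?sqr_ge0//.
  by rewrite ler_pXn2r ?nnegrE ?normc_ge0.
rewrite -mulr_sumr exprMn ler_wpM2l ?sqr_ge0//.
rewrite -(big_map (fun n => n + k) xpredT (fun n => normc (psi n) ^+ 2)).
by apply: seqnorm_sum; rewrite ?l2valP// map_inj_uniq//; exact: addIr.
Qed.

Lemma exists_l2_delta (m : int) :
  exists phi : l2 R, (forall n, phi n = (n == m)%:R) /\ seqnorm phi <= 1.
Proof.
have h : (sqsum (fun n : int => (n == m)%:R : R[i]) <= (1 ^+ 2)%:E)%E.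
  apply/sqsum_leP => s us; have [ms|ms] := boolP (m \in s).
    rewrite (bigD1_seq m)//= eqxx big1 ?addr0 ?normc1 ?expr1n// => n /negPf ->.
    by rewrite normc0 expr0n.
  rewrite big1_seq ?expr1n// => n /andP[_ ns]; have [nm|_] := eqVneq n m.
    by rewrite -nm ns in ms.
  by rewrite normc0 expr0n.
by exists (L2 (square_summableI h)); split => //; exact: seqnorm_le.
Qed.

Definition l2_delta (m : int) : l2 R := projT1 (cid (exists_l2_delta m)).

Lemma l2_deltaE m n : l2_delta m n = (n == m)%:R.
Proof. by rewrite /l2_delta; case: cid => phi []. Qed.

Lemma seqnorm_delta m : seqnorm (l2_delta m) <= 1.
Proof. by rewrite /l2_delta; case: cid => phi []. Qed.

Lemma exists_l2_cut (m : int) psi :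
  exists phi : l2 R, forall n, phi n = if m <= n then psi n else 0.
Proof.
have [|phi [h _]] := @exists_wshift (fun n => (m <= n)%R%:R) 1 0 psi.
  by move=> n; case: (m <= n); rewrite ?normc1 ?normc0.
exists phi => n; rewrite h addr0.
by case: (m <= n); rewrite ?mul1r ?mul0r.
Qed.

Definition l2_cut (m : int) psi : l2 R := projT1 (cid (exists_l2_cut m psi)).

Lemma l2_cutE m psi n : l2_cut m psi n = if m <= n then psi n else 0.
Proof. by rewrite /l2_cut; case: cid. Qed.

End l2_space.

(** * Geometric and Neumann series in [l2] *)

Section neumann.
Context {R : realType}.
Implicit Types (psi phi g : l2 R).

Lemma le0_of_half_expn (C x : R) :
  (forall k : nat, x <= C * 2^-1 ^+ k) -> x <= 0.
Proof.
move=> h; rewrite -[leRHS](mulr0 C).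
have h2 : `|2^-1 : R| < 1 by rewrite ger0_norm ?invr_ge0// invf_lt1// ltr1n.
have cv : (fun k : nat => C * 2^-1 ^+ k) @ \oo --> C * 0.
  by apply: cvgM; [exact: cvg_cst|exact: cvg_expr].
by apply: (cvgr_to_ge cv); near=> k; apply: h.
Unshelve. all: by end_near. Qed.

(** Real and imaginary parts are bounded by the modulus, so each converges by comparison with a real
    geometric series. *)
Lemma complex_geometric_cvg (z : nat -> R[i]) (C : R) :
  (forall k, normc (z k) <= C * 2^-1 ^+ k) ->
  exists w : R[i], (fun k => complex.Re (\sum_(i < k) z i)) @ \oo --> complex.Re w /\
                   (fun k => complex.Im (\sum_(i < k) z i)) @ \oo --> complex.Im w.
Proof.
move=> hz; have C0 : 0 <= C.
  by have := hz 0%N; rewrite expr0 mulr1; apply: le_trans; exact: normc_ge0.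
have h2 : `|2^-1 : R| < 1 by rewrite ger0_norm ?invr_ge0// invf_lt1// ltr1n.
have cv (u : R ^nat) : (forall k, `|u k| <= C * 2^-1 ^+ k) -> cvgn (series u).
  move=> hu; apply: normed_cvg; apply: (@series_le_cvg _ _ (geometric C 2^-1)) => //.
  - by move=> k /=; exact: normr_ge0.
  - by move=> k; rewrite /geometric/= mulr_ge0// exprn_ge0// invr_ge0.
  - exact: is_cvg_geometric_series.
have Rez k : `|complex.Re (z k)| <= C * 2^-1 ^+ k.
  apply: le_trans (hz k); case: (z k) => x y /=.
  by rewrite -sqrtr_sqr ler_sqrt ?lerDl ?addr_ge0 ?sqr_ge0.
have Imz k : `|complex.Im (z k)| <= C * 2^-1 ^+ k.
  apply: le_trans (hz k); case: (z k) => x y /=.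
  by rewrite -sqrtr_sqr ler_sqrt ?lerDr ?addr_ge0 ?sqr_ge0.
have /cvg_ex[x hx] := cv _ Rez; have /cvg_ex[y hy] := cv _ Imz.
exists (x +i* y); split => /=.
- apply: cvg_trans hx; apply: near_eq_cvg; near=> k.
  by rewrite /series/= big_mkord (big_morph (@complex.Re R) (id1 := 0) (op1 := +%R))//
    => -[? ?] [].
- apply: cvg_trans hy; apply: near_eq_cvg; near=> k.
  by rewrite /series/= big_mkord (big_morph (@complex.Im R) (id1 := 0) (op1 := +%R))//
    => -[? ?] [].
Unshelve. all: by end_near. Qed.

Lemma l2_sumE (I : Type) (s : seq I) (F : I -> l2 R) n :
  (\sum_(i <- s) F i) n = \sum_(i <- s) F i n.
Proof. by elim/big_rec2: _ => // i y x _ <-. Qed.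

Lemma seqnorm_sum_le (I : Type) (s : seq I) (F : I -> l2 R) :
  seqnorm (\sum_(i <- s) F i) <= \sum_(i <- s) seqnorm (F i).
Proof.
elim/big_rec2: _ => [|i y x _ h]; last by rewrite (le_trans (seqnormD _ _))// lerD2l.
by rewrite -(scale0r (0 : l2 R)) seqnormZ normc0 mul0r.
Qed.

Lemma cvg_sum_seq (I : Type) (s : seq I) (u : I -> R ^nat) (l : I -> R) :
  (forall i, u i @ \oo --> l i) ->
  (fun k => \sum_(i <- s) u i k) @ \oo --> \sum_(i <- s) l i.
Proof.
move=> ul; elim: s => [|i s IH].
  by under eq_fun do rewrite big_nil; rewrite big_nil; exact: cvg_cst.
by under eq_fun do rewrite big_cons; rewrite big_cons; exact: cvgD.
Qed.

(** This takes the place of completeness. Coordinates converge by comparison with a geometric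
    series, and the bound on differences of partial sums passes to the limit on each finite set of
    sites, as in Fatou's lemma. *)
Lemma l2_geometric_cvg (phi : nat -> l2 R) (C : R) :
  (forall k, seqnorm (phi k) <= C * 2^-1 ^+ k) ->
  exists psi : l2 R, forall k,
    seqnorm (psi - \sum_(i < k) phi i) <= C * 2 * 2^-1 ^+ k.
Proof.
move=> hphi; have C0 : 0 <= C.
  by have := hphi 0%N; rewrite expr0 mulr1; apply: le_trans; exact: seqnorm_ge0.
have /choice[w hw] n : exists w : R[i],
    (fun k => complex.Re (\sum_(i < k) phi i n)) @ \oo --> complex.Re w /\
    (fun k => complex.Im (\sum_(i < k) phi i n)) @ \oo --> complex.Im w.
  apply: (@complex_geometric_cvg (fun i => phi i n) C) => k.
  exact: le_trans (normc_le_seqnorm _ _) (hphi k).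
pose S k := \sum_(i < k) phi i.
have tail k l : seqnorm (S (k + l)%N - S k) <= C * 2 * 2^-1 ^+ k.
  rewrite /S big_split_ord/= addrAC subrr add0r.
  apply: (@le_trans _ _ (\sum_(i < l) seqnorm (phi (k + i)%N))); first exact: seqnorm_sum_le.
  (* The factor [1 - 2^-1 ^+ l], from the exact finite geometric sum, lets the induction on [l]
     close. *)
  apply: (@le_trans _ _ (C * 2 * 2^-1 ^+ k * (1 - 2^-1 ^+ l))); last first.
    apply: ler_piMr; first by rewrite !mulr_ge0 ?exprn_ge0 ?invr_ge0.
    by rewrite lerBlDr lerDl exprn_ge0// invr_ge0.
  elim: l => [|l IH]; first by rewrite big_ord0 expr0 subrr mulr0.
  rewrite big_ord_recr/=; apply: (le_trans (lerD IH (hphi _))).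
  by rewrite exprD exprS; lra.
have fat k (s : seq int) : uniq s ->
    \sum_(n <- s) normc (w n - S k n) ^+ 2 <= (C * 2 * 2^-1 ^+ k) ^+ 2.
  move=> us.
  pose F l := \sum_(n <- s) ((complex.Re (S l n) - complex.Re (S k n)) ^+ 2 +
                             (complex.Im (S l n) - complex.Im (S k n)) ^+ 2).
  have FE (z z' : R[i]) : normc (z - z') ^+ 2 =
      (complex.Re z - complex.Re z') ^+ 2 + (complex.Im z - complex.Im z') ^+ 2.
    by case: z => ? ?; case: z' => ? ? /=; rewrite sqr_sqrtr// addr_ge0// sqr_ge0.
  have Fcvg : F @ \oo --> \sum_(n <- s) normc (w n - S k n) ^+ 2.
    apply: cvg_sum_seq => n; rewrite FE; have [hR hI] := hw n.
    have SE l : S l n = \sum_(i < l) phi i n by exact: l2_sumE.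
    have hR' : (fun l => complex.Re (S l n)) @ \oo --> complex.Re (w n).
      by under eq_fun do rewrite SE.
    have hI' : (fun l => complex.Im (S l n)) @ \oo --> complex.Im (w n).
      by under eq_fun do rewrite SE.
    by apply: cvgD; apply: cvgM; apply: cvgB => //; exact: cvg_cst.
  apply: (cvgr_to_le Fcvg); exists k => //= l /= kl.
  rewrite /F; under eq_bigr do rewrite -FE.
  apply: (@le_trans _ _ (seqnorm (S l - S k) ^+ 2)).
    exact: (@seqnorm_sum _ (S l - S k) s (l2valP _)).
  rewrite ler_pXn2r ?nnegrE ?seqnorm_ge0 ?mulr_ge0 ?exprn_ge0 ?invr_ge0//.
  by have := tail k (l - k)%N; rewrite subnKC.
have hw2 : w \in square_summable.
  apply: (@square_summableI _ _ ((C * 2 * 2^-1 ^+ 0) ^+ 2)); apply/sqsum_leP => s us.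
  by have := fat 0%N s us; rewrite /S big_ord0; under eq_bigr do rewrite subr0.
exists (L2 hw2) => k; apply: seqnorm_leP => [|s us]; last exact: fat.
by rewrite !mulr_ge0 ?exprn_ge0 ?invr_ge0.
Qed.

(** The solution is the Neumann series of the iterates of [S] at [g]. Compatibility with differences
    gives additivity, hence the action of [S] on partial sums. *)
Lemma solve_half_contraction (S : l2 R -> l2 R) :
  (forall psi phi, S (psi - phi) = S psi - S phi) ->
  (forall psi, seqnorm (S psi) <= 2^-1 * seqnorm psi) ->
  forall g, exists psi, psi - S psi = g /\ seqnorm psi <= 2 * seqnorm g.
Proof.
move=> SB Sle g.
have S0 : S 0 = 0 by rewrite -[in LHS](subrr (0 : l2 R)) SB subrr.
have SD psi phi : S (psi + phi) = S psi + S phi.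
  by rewrite -[phi in LHS]opprK SB -[- phi]sub0r SB S0 sub0r opprK.
have Ssum k : S (\sum_(i < k) iter i S g) = \sum_(i < k) iter i.+1 S g.
  by elim: k => [|k IH]; rewrite ?big_ord0// !big_ord_recr/= SD IH.
have hk k : seqnorm (iter k S g) <= seqnorm g * 2^-1 ^+ k.
  elim: k => [|k IH]; first by rewrite expr0 mulr1.
  by rewrite iterS (le_trans (Sle _))// exprS mulrCA ler_wpM2l// invr_ge0.
have [psi hpsi] := l2_geometric_cvg hk.
exists psi; split; last first.
  by have := hpsi 0%N; rewrite big_ord0 subr0 expr0 mulr1 mulrC.
apply/eqP; rewrite -subr_eq0; apply/eqP/seqnorm_eq0/eqP.
(* The residual consists of a tail, of norm at most twice [seqnorm g * 2^-1 ^+ k], its image under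
   [S], and [iter k S g]; the last two are each half as large, which makes 4. *)
rewrite eq_le seqnorm_ge0 andbT; apply: (@le0_of_half_expn (seqnorm g * 4)) => k.
have -> : psi - S psi - g = (psi - \sum_(i < k) iter i S g) -
    (S (psi - \sum_(i < k) iter i S g) + iter k S g).
  rewrite SB Ssum; have : \sum_(i < k) iter i.+1 S g + g = 
     \sum_(i < k) iter i S g + iter k S g.
    transitivity (\sum_(i < k.+1) iter i S g); first by rewrite big_ord_recl/= addrC.
    by rewrite big_ord_recr.
  move: (\sum_(i < k) iter i S g) (\sum_(i < k) iter i.+1 S g) => u v uv.
  have -> : iter k S g = v + (g - u) by rewrite addrA uv addrC addKr.
  by rewrite subrKA opprD opprB addrACA addKr.
apply: (le_trans (seqnormD _ _)); rewrite seqnormN.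
have h1 := hpsi k; have h2 := Sle (psi - \sum_(i < k) iter i S g); have h3 := hk k.
have h4 := seqnormD (S (psi - \sum_(i < k) iter i S g)) (iter k S g).
lra.
Qed.

End neumann.

(** * Weighted shifts and bounded inverses *)

Section weighted_shift.
Context {R : realType}.
Implicit Types (psi phi g : l2 R).

(** Let [T] be the weighted shift. Only [T^L] is known to halve norms, so [1 - T^L] is inverted
    first, and [(1 - T)(1 + T + ... + T^(L-1)) = 1 - T^L] then solves the equation for [1 - T]. *)
Lemma wshift_solve (c : int -> R[i]) (k : int) (M : R) (L : nat) :
  (forall n, normc (c n) <= M) ->
  (forall n, normc (\prod_(i < L) c (n + k *+ i)) <= 2^-1) ->
  exists2 C : R, 0 <= C & forall g, exists psi,
    (forall n, psi n - c n * psi (n + k) = g n) /\ seqnorm psi <= C * seqnorm g.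
Proof.
move=> cM cL; have M0 : 0 <= M by rewrite (le_trans _ (cM 0))// normc_ge0.
have /choice[T hT] psi := exists_wshift k psi cM.
have TE psi n : T psi n = c n * psi (n + k) by case: (hT psi).
have TM psi : seqnorm (T psi) <= M * seqnorm psi by case: (hT psi).
have TB psi phi : T (psi - phi) = T psi - T phi.
  by apply: l2_eqP => n; rewrite l2_subE !TE mulrBr.
have iterE i psi n :
    iter i T psi n = (\prod_(l < i) c (n + k *+ l)) * psi (n + k *+ i).
  elim: i n => [|i IH] n; first by rewrite big_ord0 mul1r mulr0n addr0.
  rewrite iterS TE IH big_ord_recl/= mulr0n addr0 -mulrA -addrA -mulrS.
  by congr (_ * (_ * _)); apply: eq_bigr => l _; rewrite -addrA -mulrS.
have TLB psi phi : iter L T (psi - phi) = iter L T psi - iter L T phi.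
  by elim: L {cL iterE} => //= i ->; rewrite TB.
have TLM psi : seqnorm (iter L T psi) <= 2^-1 * seqnorm psi.
  have [phi [phiE]] := exists_wshift (k *+ L) psi cL.
  by congr (_ <= _); congr seqnorm; apply/funext => n; rewrite phiE iterE.
have iterM i psi : seqnorm (iter i T psi) <= M ^+ i * seqnorm psi.
  elim: i => [|i IH]; first by rewrite expr0 mul1r.
  by rewrite iterS (le_trans (TM _))// exprS -mulrA ler_wpM2l.
(* The sum bounds the norm of [1 + T + ... + T^(L-1)], the factor 2 that of the inverse of
   [1 - T^L]. *)
exists ((\sum_(i < L) M ^+ i) * 2) => [|g].
  by rewrite mulr_ge0// sumr_ge0// => i _; rewrite exprn_ge0.
have [phi [phiE phig]] := solve_half_contraction TLB TLM g.
exists (\sum_(i < L) iter i T phi); split => [n|].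
  rewrite -TE -l2_subE -phiE; congr (l2val _ n).
  elim: L {cL iterE TLB TLM phiE phig iterM} => [|i IH].
    by rewrite big_ord0/= [T 0](_ : _ = 0) ?subrr// -[in LHS](subrr (0 : l2 R)) TB subrr.
  rewrite big_ord_recr/=.
  have TD psi1 psi2 : T (psi1 + psi2) = T psi1 + T psi2.
    by apply: l2_eqP => m; rewrite l2_addE !TE mulrDr.
  by rewrite TD opprD addrACA IH addrA subrK.
apply: (le_trans (seqnorm_sum_le _ _)).
rewrite -mulrA mulr_suml; apply: ler_sum => i _.
by rewrite (le_trans (iterM _ _))// ler_wpM2l// exprn_ge0.
Qed.

(** Iterated [L] times, the relation bounds the norm of [psi] by half of itself. *)
Lemma wshift_inj (c : int -> R[i]) (k : int) (L : nat) psi :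
  (forall n, normc (\prod_(i < L) c (n + k *+ i)) <= 2^-1) ->
  (forall n, psi n = c n * psi (n + k)) -> psi = 0.
Proof.
move=> cL h.
have hL i n : psi n = (\prod_(l < i) c (n + k *+ l)) * psi (n + k *+ i).
  elim: i n => [|i IH] n; first by rewrite big_ord0 mul1r mulr0n addr0.
  rewrite h IH big_ord_recl/= mulr0n addr0 -mulrA -addrA -mulrS.
  by congr (_ * (_ * _)); apply: eq_bigr => l _; rewrite -addrA -mulrS.
have [phi [phiE]] := exists_wshift (k *+ L) psi cL.
have -> : phi = psi by apply: l2_eqP => n; rewrite phiE -hL.
move=> le; apply: seqnorm_eq0; have := seqnorm_ge0 psi; lra.
Qed.

End weighted_shift.

(** * Bounded invertibility in terms of norm estimates *)

Section resolvent.
Context {R : realType}.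
Implicit Types (psi phi g : l2 R).

Lemma normE_l2 psi : `|psi| = (seqnorm psi)%:C. Proof. by []. Qed.

(** Uniqueness makes the chosen solution map linear, and the estimate makes it continuous. *)
Lemma boundedly_invertible_intro (A : {linear l2 R -> l2 R}) (E : R[i]) (C : R) :
  (forall g, exists psi, A psi - E *: psi = g /\ seqnorm psi <= C * seqnorm g) ->
  (forall psi, A psi - E *: psi = 0 -> psi = 0) ->
  boundedly_invertible (fun v => A v - E *: v).
Proof.
move=> /choice[G hG] inj.
have GE g : A (G g) - E *: G g = g by case: (hG g).
have injB psi phi : A psi - E *: psi = A phi - E *: phi -> psi = phi.
  move=> /eqP; rewrite -subr_eq0 => /eqP h; apply/eqP; rewrite -subr_eq0.
  by apply/eqP/inj; rewrite -[RHS]h linearB scalerBr !opprD !opprK addrACA.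
have Glin : linear G.
  move=> k psi phi; apply: injB; rewrite GE linearP scalerDr opprD addrACA GE.
  by rewrite scalerA mulrC -scalerA -scalerBr GE.
pose GL : {linear l2 R -> l2 R} :=
  HB.pack G (GRing.isLinear.Build R[i] (l2 R) (l2 R) *:%R G Glin).
exists GL; split.
- apply/linear_bounded_continuous/linear_boundedP.
  exists (C%:C); split; first by rewrite complex_real.
  move=> r Cr psi; apply: (@le_trans _ _ (C%:C * `|psi|)).
    by rewrite !normE_l2 -rmorphM lecR; case: (hG psi).
  by rewrite ler_wpM2r// ltW.
- by move=> psi; apply: injB; rewrite GE.
- by move=> g; exact: GE.
Qed.

(** A bound from below and surjectivity are all that the converse direction takes from
    invertibility. *)
Lemma boundedly_invertible_elim (T : l2 R -> l2 R) : boundedly_invertible T ->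
  (exists2 K : R, 0 < K & forall psi, seqnorm psi <= K * seqnorm (T psi)) /\
  (forall g, exists psi, T psi = g).
Proof.
case=> G [Gc GT TG]; split; last by move=> g; exists (G g); rewrite TG.
move/linear_bounded_continuous/linear_boundedP : Gc => [M [Mr hM]].
(* [M] is a real element of the complex scalars; the maximum with 1 makes the constant positive. *)
exists (Num.max 1 (complex.Re (M + 1))) => [|psi]; first by rewrite lt_max ltr01.
have := hM (M + 1); rewrite ltrDl ltr01 => /(_ isT (T psi)).
have -> : M + 1 = (complex.Re (M + 1))%:C.
  by rewrite RRe_real ?realD ?real1.
rewrite GT !normE_l2 -rmorphM lecR => h.
by rewrite (le_trans h)// ler_wpM2r ?seqnorm_ge0// le_max lexx orbT.
Qed.

End resolvent.

(** * From dominated splitting to the resolvent *)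

Section contraction_rate.
Context {R : realType}.

Lemma exists_expn_ge (lambda x : R) : 1 < lambda -> exists m : nat, x <= lambda ^+ m.
Proof.
move=> l1; have l0 : 0 < lambda - 1 by rewrite subr_gt0.
(* Bernoulli's inequality without its summand 1. *)
have bern m : m%:R * (lambda - 1) <= lambda ^+ m.
  elim: m => [|m IH]; first by rewrite mul0r expr0.
  have : 1 <= lambda ^+ m by rewrite exprn_ege1// ltW.
  rewrite exprS -natr1 => h1.
  have : lambda - 1 <= (lambda - 1) * lambda ^+ m by rewrite ler_peMr// ltW.
  lra.
exists (Num.truncn `|x / (lambda - 1)|).+1; apply: le_trans (bern _).
rewrite -ler_pdivrMr//; apply: le_trans (ler_norm _) _.
by apply: ltW; apply: truncnS_gt.
Qed.

Lemma domination_iter (mu nu : int -> R) (N m : nat) (lambda : R) :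
  0 <= lambda -> (forall n, 0 <= mu n) -> (forall n, 0 <= nu n) ->
  (forall n, lambda * \prod_(i < N) nu (n + i%:Z) <= \prod_(i < N) mu (n + i%:Z)) ->
  forall n, lambda ^+ m * \prod_(i < m * N) nu (n + i%:Z) <=
            \prod_(i < m * N) mu (n + i%:Z).
Proof.
move=> l0 mu0 nu0 dom n; elim: m => [|m IH].
  by rewrite mul0n !big_ord0 expr0 mulr1.
rewrite mulSnr !big_split_ord/= exprSr mulrACA.
have h := dom (n + (m * N)%N%:Z).
apply: ler_pM => //.
- by rewrite mulr_ge0 ?exprn_ge0 ?prodr_ge0.
- by rewrite mulr_ge0 ?prodr_ge0.
- by congr (_ * _ <= _): h; apply: eq_bigr => i _; rewrite PoszD addrA.
Qed.

(* The identity [mu n * nu n * D (n + 1) = A n * A (n - 1) * D n] (a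
   determinant computation) makes the square of a product of the [A n]
   comparable with the product of the [mu n * nu n], hence, by domination,
   negligible with respect to the square of the product of the [mu n]. *)
Lemma domination_contraction (A mu nu D : int -> R) (M c d : R) (N : nat)
    (lambda eps : R) :
  0 < c -> 0 < d -> 1 < lambda -> 0 < eps ->
  (forall n, 0 <= A n <= M) -> (forall n, c <= mu n) -> (forall n, 0 <= nu n) ->
  (forall n, d <= D n <= 2) ->
  (forall n, mu n * nu n * D (n + 1) = A n * A (n - 1) * D n) ->
  (forall n, lambda * \prod_(i < N) nu (n + i%:Z) <= \prod_(i < N) mu (n + i%:Z)) ->
  exists L : nat, forall n,
    \prod_(i < L) A (n + i%:Z) <= eps * \prod_(i < L) mu (n + i%:Z).
Proof.
move=> c0 d0 l1 e0 AM cmu nu0 dD munu dom.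
have mu0 n : 0 <= mu n by rewrite (le_trans _ (cmu n))// ltW.
have A0 n : 0 <= A n by case/andP: (AM n).
have M0 : 0 <= M by case/andP: (AM 0) => /le_trans; apply.
(* [m] is chosen so that [lambda ^+ m] absorbs every constant of the final comparison. *)
have [m hm] := exists_expn_ge (2 * M ^+ 2 / (d * c ^+ 2 * eps ^+ 2)) l1.
have hm' : 2 * M ^+ 2 <= lambda ^+ m * (d * c ^+ 2 * eps ^+ 2).
  by rewrite -ler_pdivrMr// !mulr_gt0// exprn_gt0.
(* One site more than [m] windows of length [N]: each product [mu * nu] accounts for two
   neighbouring values of [A]. *)
exists (m * N).+1 => n.
(* The determinant identities telescope. Neighbouring values of [A] are paired, and of the square
   only one factor at each end, [A n] and [A (n + K)], is left over. *)
have key K : (\prod_(i < K.+1) A (n + i%:Z)) ^+ 2 * D (n + 1) =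
    A n * A (n + K%:Z) * (\prod_(i < K) mu (n + 1 + i%:Z) *
      \prod_(i < K) nu (n + 1 + i%:Z)) * D (n + K%:Z + 1).
  elim: K => [|K IH]; first by rewrite big_ord1 !big_ord0 addr0 !mulr1.
  rewrite big_ord_recr/= exprMn mulrAC IH !big_ord_recr/=.
  have := munu (n + K%:Z + 1); rewrite addrK.
  have -> : n + K.+1%:Z = n + K%:Z + 1 by lia.
  have -> : n + 1 + K%:Z = n + K%:Z + 1 by lia.
  move: (D (n + K%:Z + 1)) (D (n + K%:Z + 1 + 1)) (mu _) (nu _) (\prod_(i < K) _) (\prod_(i < K) _).
  move=> D1 D2 m1 n1 P1 P2 e.
  transitivity (A n * A (n + K%:Z + 1) * P1 * P2 * (A (n + K%:Z + 1) * A (n + K%:Z) * D1)).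
    by ring.
  by rewrite -e; ring.
set K := (m * N)%N; have {key} := key K.
have := domination_iter m (ltW (lt_trans ltr01 l1)) mu0 nu0 dom (n + 1).
rewrite [\prod_(i < K.+1) mu _]big_ord_recl/= addr0.
have -> : \prod_(i < K) mu (n + (bump 0 i)%:Z) = \prod_(i < K) mu (n + 1 + i%:Z).
  by apply: eq_bigr => i _; congr mu; rewrite /bump; lia.
rewrite -/K; set Q := \prod_(i < K) mu _; set V := \prod_(i < K) nu _.
set P := \prod_(i < K.+1) A _ => VQ key.
have P0 : 0 <= P by apply: prodr_ge0.
have Q0 : 0 <= Q by apply: prodr_ge0.
have V0 : 0 <= V by apply: prodr_ge0.
have := dD (n + 1); have := dD (n + K%:Z + 1).
move: (D (n + 1)) (D (n + K%:Z + 1)) key => D1 D2 key /andP[dD2 D22] /andP[dD1 _].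
have /andP[_ AM1] := AM n; have /andP[_ AM2] := AM (n + K%:Z).
have D20 : 0 <= D2 by rewrite (le_trans _ dD2)// ltW.
have PV : P ^+ 2 * d <= 2 * M ^+ 2 * (V * Q).
  apply: (@le_trans _ _ (P ^+ 2 * D1)); first by rewrite ler_wpM2l ?sqr_ge0.
  rewrite key (_ : 2 * M ^+ 2 * (V * Q) = M * M * (Q * V) * 2); last by ring.
  have AA : A n * A (n + K%:Z) <= M * M by apply: ler_pM.
  by apply: ler_pM => //; rewrite ?mulr_ge0// ler_wpM2r// mulr_ge0.
rewrite -(ler_pXn2r (_ : 0 < 2)%N) ?nnegrE ?mulr_ge0 ?(ltW e0)//.
rewrite -(ler_pM2r d0); apply: (le_trans PV).
apply: (@le_trans _ _ (lambda ^+ m * (d * c ^+ 2 * eps ^+ 2) * (V * Q))).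
  by rewrite ler_wpM2r ?mulr_ge0.
rewrite [leLHS](_ : _ = lambda ^+ m * V * (d * c ^+ 2 * eps ^+ 2 * Q)); last by ring.
apply: (@le_trans _ _ (Q * (d * c ^+ 2 * eps ^+ 2 * Q))).
  by rewrite ler_wpM2r// mulr_ge0// mulr_ge0 ?sqr_ge0// mulr_ge0 ?sqr_ge0// ltW.
(* Here [c ^+ 2] is traded for [mu n ^+ 2], the square of the factor missing from [Q]. *)
rewrite [leLHS](_ : _ = c ^+ 2 * (Q ^+ 2 * eps ^+ 2 * d)); last by ring.
rewrite [leRHS](_ : _ = mu n ^+ 2 * (Q ^+ 2 * eps ^+ 2 * d)); last by ring.
apply: ler_wpM2r; first by rewrite mulr_ge0 ?(ltW d0)// mulr_ge0 ?sqr_ge0.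
by rewrite ler_pXn2r ?nnegrE ?(ltW c0).
Qed.

End contraction_rate.

(** * Linear algebra of the frames at two consecutive sites *)

Section frame_algebra.
Context {F : fieldType}.
(** At a site [n], [e] stands for [E - b n], [an] for [a n] and [a'] for the conjugate of
    [a (n - 1)]. The frame vectors are [(p, q)] and [(r, t)]; the suffix 1 marks the frame at
    [n + 1]. *)
Variables (e an a' mu nu p q r t p1 q1 r1 t1 D D1 : F).
Hypotheses (mu0 : mu != 0) (D0 : D != 0) (D10 : D1 != 0).
Hypotheses (DE : D = p * t - q * r) (D1E : D1 = p1 * t1 - q1 * r1).
Hypotheses (up : mu * p1 = e * p - a' * q) (uq : mu * q1 = an * p).
Hypotheses (sr : nu * r1 = e * r - a' * t) (st : nu * t1 = an * r).

(** The product [an * a'] is the determinant of the cocycle matrix. *)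
Lemma frame_det : mu * nu * D1 = an * a' * D.
Proof.
transitivity (mu * p1 * (nu * t1) - mu * q1 * (nu * r1)); first by rewrite D1E; ring.
by rewrite up uq sr st DE; ring.
Qed.

(** This recovers [r] from [t1] with only [mu] and [D1] as divisors, whereas [nu * t1 = an * r]
    would call for division by [an]. *)
Lemma frame_cross : r * (mu * D1) = a' * t1 * D.
Proof.
transitivity (r * (mu * p1 * t1 - mu * q1 * r1)); first by rewrite D1E; ring.
rewrite up uq.
transitivity (r * (e * p - a' * q) * t1 - p * r1 * (an * r)); first by ring.
rewrite -st (_ : p * r1 * (nu * t1) = p * t1 * (nu * r1)); last by ring.
by rewrite sr DE; ring.
Qed.

(** Both sides stand for the value of the solution at [n]: the first component in the frame at [n],
    and the second component in the frame at [n + 1]. *)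
Lemma frame_consistent X X1 W' W f :
  X - an / mu * X1 = - (t1 / (mu * D1) * f) ->
  W - a' / mu * W' = - (p / mu * f) ->
  X * p + W' * r / D = X1 * q1 + W * t1 / D1.
Proof.
move=> /eqP; rewrite subr_eq => /eqP -> /eqP; rewrite subr_eq => /eqP ->.
have -> : q1 = an * p / mu by rewrite -uq mulrC mulKf.
have -> : r = a' * t1 * D / (mu * D1) by rewrite -frame_cross mulfK// mulf_neq0.
by field; rewrite D10 mu0 D0.
Qed.

(** The three brackets are the values at [n - 1], [n + 1] and [n]. *)
Lemma frame_solution X X1 W' W f :
  X - an / mu * X1 = - (t1 / (mu * D1) * f) ->
  W - a' / mu * W' = - (p / mu * f) ->
  a' * (X * q + W' * t / D) + an * (X1 * p1 + W * r1 / D1) -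
    e * (X * p + W' * r / D) = f.
Proof.
move=> hX hW.
transitivity (an * X1 * p1 + an * W * r1 / D1 - X * (e * p - a' * q) -
              W' / D * (e * r - a' * t)); first by field; rewrite D0 D10.
rewrite -up -sr; move/eqP: hX; rewrite subr_eq => /eqP ->.
move/eqP: hW; rewrite subr_eq => /eqP ->.
have -> : nu = an * a' * D / (mu * D1) 
  by rewrite -frame_det [mu * nu * D1]mulrAC [_ * nu]mulrC mulfK// mulf_neq0.
transitivity (f * (p1 * t1 - an * p / mu * r1) / D1); first by field; rewrite D0 D10 mu0.
by rewrite -uq (mulrC mu) mulfK// -D1E mulfK.
Qed.

(** By Cramer's rule the fraction on the left is the coordinate of [(x, x0)] along [(p, q)]; the one
    on the right is its analogue at the next site. *)
Lemma frame_coordX x0 x x1 : a' * x0 + an * x1 - e * x = 0 ->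
  (x * t - x0 * r) / D = an / mu * ((x1 * t1 - x * r1) / D1).
Proof.
move=> h; apply: (mulIf D0); apply: (mulIf D10); apply: (mulfI mu0).
transitivity (mu * D1 * (x * t) - r * (mu * D1) * x0); first by field; rewrite D0.
have muD1 : mu * D1 = (e * p - a' * q) * t1 - an * p * r1.
  by rewrite -up -uq D1E; ring.
rewrite frame_cross; transitivity ((an * x1) * t1 * D - an * x * r1 * D); last first.
  by field; rewrite D10 mu0.
have -> : an * x1 = e * x - a' * x0 by apply/eqP; rewrite -subr_eq0 -h; apply/eqP; ring.
suff muDt : mu * D1 * t = e * t1 * D - an * r1 * D.
  transitivity (x * (mu * D1 * t) - a' * t1 * D * x0); first by ring.
  by rewrite muDt; ring.
rewrite muD1; transitivity (e * p * t * t1 - a' * t * t1 * q - an * r1 * (p * t)).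
  by ring.
have -> : a' * t = e * r - nu * r1 by rewrite sr; ring.
transitivity (e * t1 * (p * t - q * r) + nu * t1 * (r1 * q) - an * r1 * (p * t)).
  by ring.
by rewrite st DE; ring.
Qed.

(** The determinant of the first frame vector with the data is the coordinate along the second one,
    multiplied by [D]. *)
Lemma frame_coordW x0 x x1 : a' * x0 + an * x1 - e * x = 0 ->
  p1 * x - q1 * x1 = a' / mu * (p * x0 - q * x).
Proof.
move=> h; apply: (mulfI mu0).
transitivity (mu * p1 * x - mu * q1 * x1); first by ring.
rewrite up uq; transitivity (p * (e * x - an * x1) - a' * q * x); first by ring.
have -> : e * x - an * x1 = a' * x0 by apply/eqP; rewrite -subr_eq0 -oppr_eq0 -h; apply/eqP; ring.
by field.
Qed.

End frame_algebra.

(** * Inverting the Jacobi operator with bounded frames *)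

Section jacobi_frames.
Context {R : realType} (a : int -> R[i]) (b : int -> R).
Context (ha : bounded_fun (a : int -> R[i]^o)) (hb : bounded_fun (b : int -> R^o)).
Variable E : R[i].
Implicit Types (psi phi g : l2 R).

Lemma jacobi_subE psi n : (jacobi ha hb psi - E *: psi) n =
  (a (n - 1))^* * psi (n - 1) + a n * psi (n + 1) - (E - (b n)%:C) * psi n.
Proof.
rewrite l2_subE l2_scaleE /= /jacobi_fun.
by move: (psi _) (psi _) (psi n) => x y z; ring.
Qed.

Lemma frames_boundedly_invertible (p q r t mu nu : int -> R[i]) (N : nat)
    (lambda c d M : R) :
  0 < c -> 0 < d -> 1 < lambda ->
  (forall n, [/\ normc (p n) <= 1, normc (q n) <= 1, normc (r n) <= 1 &
                 normc (t n) <= 1]) ->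
  (forall n, mu n * p (n + 1) = (E - (b n)%:C) * p n - (a (n - 1))^* * q n) ->
  (forall n, mu n * q (n + 1) = a n * p n) ->
  (forall n, nu n * r (n + 1) = (E - (b n)%:C) * r n - (a (n - 1))^* * t n) ->
  (forall n, nu n * t (n + 1) = a n * r n) ->
  (forall n, d <= normc (p n * t n - q n * r n)) ->
  (forall n, c <= normc (mu n) <= M) ->
  (forall n, lambda * \prod_(i < N) normc (nu (n + i%:Z)) <=
             \prod_(i < N) normc (mu (n + i%:Z))) ->
  boundedly_invertible (fun v => jacobi ha hb v - E *: v).
Proof.
move=> c0 d0 l1 bd up uq sr st dD cmuM dom.
pose D n := p n * t n - q n * r n.
have cmu n : c <= normc (mu n) by case/andP: (cmuM n).
have muM n : normc (mu n) <= M by case/andP: (cmuM n).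
have M0 : 0 < M by rewrite (lt_le_trans c0)// (le_trans (cmu 0)).
have mu0 n : mu n != 0 by rewrite -normc_gt0 (lt_le_trans c0).
have D0 n : D n != 0 by rewrite -normc_gt0 (lt_le_trans d0)// dD.
have [Ma hMa] := bounded_normc ha.
have Ma0 : 0 <= Ma by rewrite (le_trans _ (hMa 0))// normc_ge0.
have DE n : D n = p n * t n - q n * r n by [].
(* The threshold [c / (2 * M)] leaves room for the factor [M / c] lost below, where the windows of
   [a] and [mu] are off by one site. *)
have [L hL] : exists L : nat, forall n, \prod_(i < L) normc (a (n + i%:Z)) <=
    (c / (2 * M)) * \prod_(i < L) normc (mu (n + i%:Z)).
  apply: (@domination_contraction _ (fun n => normc (a n)) (fun n => normc (mu n))
    (fun n => normc (nu n)) (fun n => normc (D n)) Ma c d N lambda) => //=.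
  - by rewrite divr_gt0// mulr_gt0.
  - by move=> n; rewrite normc_ge0 hMa.
  - by move=> n; exact: normc_ge0.
  - move=> n; rewrite dD/=; have [p1 q1 r1 t1] := bd n.
    apply: (le_trans (le_normcB _ _)); rewrite !normcM -[leRHS]/(1 + 1).
    by rewrite lerD// mulr_ile1// normc_ge0.
  - move=> n; rewrite -!normcM (frame_det (DE n) (DE (n + 1)) (up n) (uq n) (sr n) (st n)).
    by rewrite !normcM normc_conj.
have eps2 : c / (2 * M) <= 2^-1.
  by rewrite invfM mulrCA ler_piMr ?invr_ge0// ler_pdivrMr// mul1r (le_trans (cmu 0)).
have contrX n : normc (\prod_(i < L) (a (n + 1 *+ i) / mu (n + 1 *+ i))) <= 2^-1.
  rewrite normc_prod; under eq_bigr do rewrite normcM normcV natz.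
  rewrite big_split/= prodfV ler_pdivrMr; last by apply: prodr_gt0 => i _; rewrite normc_gt0.
  by apply: (le_trans (hL n)); rewrite ler_wpM2r// prodr_ge0// => i _; exact: normc_ge0.
have contrW n :
    normc (\prod_(i < L) ((a (n + (-1) *+ i - 1))^* / mu (n + (-1) *+ i))) <= 2^-1.
  rewrite normc_prod; under eq_bigr do rewrite normcM normcV normc_conj.
  rewrite big_split/= prodfV ler_pdivrMr; last by apply: prodr_gt0 => i _; rewrite normc_gt0.
  (* The shift to the left runs through the window backwards. After reversal the values of [a] start
     at [m] and those of [mu] at [m + 1]. *)
  rewrite (reindex_inj rev_ord_inj) [in leRHS](reindex_inj rev_ord_inj)/=.
  pose m := n - L%:Z.
  have aE (i : 'I_L) : normc (a (n + (-1) *+ (L - i.+1) - 1)) = normc (a (m + i%:Z)).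
    by congr (normc (a _)); rewrite /m mulNrn natz; have := ltn_ord i; lia.
  have mE (i : 'I_L) : normc (mu (n + (-1) *+ (L - i.+1))) = normc (mu (m + 1 + i%:Z)).
    by congr (normc (mu _)); rewrite /m mulNrn natz; have := ltn_ord i; lia.
  under eq_bigr do rewrite aE; under [in leRHS]eq_bigr do rewrite mE.
  apply: (le_trans (hL m)).
  set Q0 := \prod_(i < L) _; set Q1 := \prod_(i < L) _.
  have Q00 : 0 <= Q0 by apply: prodr_ge0 => i _; exact: normc_ge0.
  have Q10 : 0 <= Q1 by apply: prodr_ge0 => i _; exact: normc_ge0.
  (* Moving the window by one site exchanges one end factor for the other. *)
  have QE : Q0 * normc (mu (m + L%:Z)) = normc (mu m) * Q1.
    transitivity (\prod_(i < L.+1) normc (mu (m + i%:Z))); first by rewrite big_ord_recr.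
    rewrite big_ord_recl/= addr0; congr (_ * _); apply: eq_bigr => i _.
    by congr (normc (mu _)); rewrite /bump; lia.
  have h1 : Q0 * c <= M * Q1.
    apply: (@le_trans _ _ (Q0 * normc (mu (m + L%:Z)))); first by rewrite ler_wpM2l.
    by rewrite QE ler_wpM2r.
  rewrite (_ : c / (2 * M) * Q0 = 2^-1 * (Q0 * c / M)); last first.
    by field; rewrite gt_eqF.
  by rewrite ler_wpM2l ?invr_ge0// ler_pdivrMr// mulrC [Q1 * M]mulrC mulrC.
have bX n : normc (a n / mu n) <= Ma / c.
  rewrite normcM normcV ler_pM ?normc_ge0 ?invr_ge0 ?normc_ge0//.
  by rewrite lef_pV2 ?posrE ?normc_gt0.
have bW n : normc ((a (n - 1))^* / mu n) <= Ma / c.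
  rewrite normcM normcV normc_conj ler_pM ?normc_ge0 ?invr_ge0 ?normc_ge0//.
  by rewrite lef_pV2 ?posrE ?normc_gt0.
have [CX CX0 solX] := @wshift_solve R (fun n => a n / mu n) 1 _ L bX contrX.
have [CW CW0 solW] := @wshift_solve R (fun n => (a (n - 1))^* / mu n) (-1) _ L bW contrW.
have bV z : 0 < c -> c <= normc z -> normc (z^-1) <= c^-1.
  by move=> z0 cz; rewrite normcV lef_pV2// posrE// (lt_le_trans z0).
have bD n : normc (D n)^-1 <= d^-1 by rewrite normcV lef_pV2 ?posrE ?normc_gt0// dD.
have bgX n : normc (- (t (n + 1) / (mu n * D (n + 1)))) <= c^-1 * d^-1.
  have [_ _ _ t1] := bd (n + 1).
  rewrite normcN normcM -[leRHS]mul1r invfM normcM.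
  by rewrite ler_pM ?mulr_ge0 ?normc_ge0// ler_pM ?normc_ge0//; exact: bV.
have bgW n : normc (- (p n / mu n)) <= c^-1.
  have [p1 _ _ _] := bd n.
  by rewrite normcN normcM -[leRHS]mul1r ler_pM ?normc_ge0//; exact: bV.
have bp n : normc (p n) <= 1 by case: (bd n).
have br n : normc (r n / D n) <= d^-1.
  have [_ _ r1 _] := bd n.
  by rewrite normcM -[leRHS]mul1r ler_pM ?normc_ge0//; exact: bD.
(* The constants of the two recursions, each times the bound of its forcing term; the second also
   carries the bound of [r / D]. *)
apply: (@boundedly_invertible_intro _ _ _
    (CX * (c^-1 * d^-1) + d^-1 * (CW * c^-1))) => [f|psi Hpsi].
  have [gX [gXE gXb]] := exists_wshift 0 f bgX.
  have [gW [gWE gWb]] := exists_wshift 0 f bgW.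
  have [X [XE Xb]] := solX gX; have [W [WE Wb]] := solW gW.
  have [u [uE ub]] := exists_wshift 0 X bp.
  have [v [vE vb]] := exists_wshift (-1) W br.
  exists (u + v); split; last first.
    have dd : 0 <= d^-1 by rewrite invr_ge0 ltW.
    have h1 := ler_wpM2l CX0 gXb; have h2 := ler_wpM2l dd (ler_wpM2l CW0 gWb).
    have h3 := ler_wpM2l dd Wb; have h4 := seqnormD u v.
    rewrite mul1r in ub; rewrite mulrDl -!mulrA in h1 h2 h3 *.
    lra.
  have hX n : X n - a n / mu n * X (n + 1) = - (t (n + 1) / (mu n * D (n + 1)) * f n).
    by rewrite XE gXE addr0 mulNr.
  have hW n : W n - (a (n - 1))^* / mu n * W (n - 1) = - (p n / mu n * f n).
    by rewrite WE gWE addr0 mulNr.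
  have uvE n : (u + v) n = X n * p n + W (n - 1) * r n / D n.
    by rewrite l2_addE uE vE addr0 mulrC; congr (_ + _); rewrite mulrC mulrA.
  (* Taken at [n - 1], this expresses the value there in the frame at [n], as the equation at [n]
     requires. *)
  have uvE' n : (u + v) n = X (n + 1) * q (n + 1) + W n * t (n + 1) / D (n + 1).
    rewrite uvE; exact: (frame_consistent (mu0 n) (D0 n) (D0 (n + 1)) (DE n)
      (DE (n + 1)) (up n) (uq n) (sr n) (st n) (hX n) (hW n)).
  apply: l2_eqP => n; rewrite jacobi_subE (uvE' (n - 1)) subrK (uvE (n + 1)) addrK (uvE n).
  exact: (frame_solution (mu0 n) (D0 n) (D0 (n + 1)) (DE n)
    (DE (n + 1)) (up n) (uq n) (sr n) (st n) (hX n) (hW n)).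
(* Injectivity: both frame coordinates of a kernel vector solve the homogeneous recursions and
   therefore vanish. *)
have eqn n : (a (n - 1))^* * psi (n - 1) + a n * psi (n + 1) -
    (E - (b n)%:C) * psi n = 0 by rewrite -jacobi_subE Hpsi.
have bt n : normc (t n / D n) <= d^-1.
  have [_ _ _ t1] := bd n.
  by rewrite normcM -[leRHS]mul1r ler_pM ?normc_ge0//; exact: bD.
have bp1 n : normc (p (n + 1)) <= 1 by case: (bd (n + 1)).
have bq1 n : normc (q (n + 1)) <= 1 by case: (bd (n + 1)).
have [u [uE _]] := exists_wshift 0 psi bt.
have [v [vE _]] := exists_wshift (-1) psi br.
have XE n : (u - v) n = (psi n * t n - psi (n - 1) * r n) / D n.
  by rewrite l2_subE uE vE addr0; ring.
have X0 : u - v = 0.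
  apply: (@wshift_inj R (fun n => a n / mu n) 1 L _ contrX) => n; rewrite !XE addrK.
  exact: (frame_coordX (mu0 n) (D0 n) (D0 (n + 1)) (DE n)
    (DE (n + 1)) (up n) (uq n) (sr n) (st n) (eqn n)).
have [u' [uE' _]] := exists_wshift 0 psi bp1.
have [v' [vE' _]] := exists_wshift 1 psi bq1.
have WE n : (u' - v') n = p (n + 1) * psi n - q (n + 1) * psi (n + 1).
  by rewrite l2_subE uE' vE' addr0.
have W0 : u' - v' = 0.
  apply: (@wshift_inj R (fun n => (a (n - 1))^* / mu n) (-1) L _ contrW) => n; rewrite !WE subrK.
  exact: (frame_coordW (mu0 n) (up n) (uq n) (eqn n)).
apply: l2_eqP => n; apply: (mulIf (D0 n)); rewrite l2_0E mul0r.
have := XE n; rewrite X0 l2_0E => /esym/eqP.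
rewrite mulf_eq0 invr_eq0 (negPf (D0 n)) orbF => /eqP hX.
have := WE (n - 1); rewrite W0 l2_0E subrK => /esym hW.
transitivity ((psi n * t n - psi (n - 1) * r n) * p n +
              (p n * psi (n - 1) - q n * psi n) * r n); first by rewrite DE; ring.
by rewrite hX hW !mul0r addr0.
Qed.

End jacobi_frames.

(** * Euclidean geometry of the plane and action of the cocycle *)

Section plane.
Context {R : realType}.
Implicit Types (v w : 'cV[R[i]]_2).

Lemma ord2E (P : 'I_2 -> Prop) : P 0 -> P 1 -> forall i, P i.
Proof.
move=> P0 P1 [[|[|]]]//= h; [move: P0|move: P1]; congr P; exact: val_inj.
Qed.

Lemma sum_ord2 (V : nmodType) (F : 'I_2 -> V) : \sum_i F i = F 0 + F 1.
Proof. by rewrite !big_ord_recl big_ord0 addr0; congr (F _ + F _); exact: val_inj. Qed.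

Lemma cV2_eqP v w : v 0 0 = w 0 0 -> v 1 0 = w 1 0 -> v = w.
Proof.
by move=> h0 h1; apply/matrixP => i j; rewrite (ord1 j); move: i; apply: ord2E.
Qed.

Lemma enorm_sqr v : enorm v ^+ 2 = normc (v 0 0) ^+ 2 + normc (v 1 0) ^+ 2.
Proof. by rewrite /enorm sum_ord2 sqr_sqrtr// addr_ge0 ?sqr_ge0. Qed.

Lemma enorm_ge0 v : 0 <= enorm v. Proof. exact: sqrtr_ge0. Qed.

Lemma normc_le_enorm v i : normc (v i 0) <= enorm v.
Proof.
rewrite -(ler_pXn2r (_ : 0 < 2)%N) ?nnegrE ?normc_ge0 ?enorm_ge0// enorm_sqr.
by move: i; apply: ord2E; rewrite ?lerDl ?lerDr sqr_ge0.
Qed.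

Lemma enorm_le_add v : enorm v <= normc (v 0 0) + normc (v 1 0).
Proof.
rewrite -(ler_pXn2r (_ : 0 < 2)%N) ?nnegrE ?addr_ge0 ?normc_ge0 ?enorm_ge0//.
rewrite enorm_sqr sqrrD -addrA lerD2l addrC lerDl.
by rewrite mulrn_wge0// mulr_ge0 ?normc_ge0.
Qed.

Lemma enorm_gt0 v : v != 0 -> 0 < enorm v.
Proof.
move=> v0; rewrite lt_neqAle enorm_ge0 andbT eq_sym; apply: contra v0 => /eqP h.
have z i : v i 0 = 0.
  by apply: eq0_normc; apply/eqP; rewrite eq_le normc_ge0 andbT -h normc_le_enorm.
by apply/eqP/cV2_eqP; rewrite z mxE.
Qed.

Lemma det_row_cV2 v w : \det (row_mx v w : 'M[R[i]]_2) = v 0 0 * w 1 0 - v 1 0 * w 0 0.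
Proof.
have e0 i : (row_mx v w : 'M[R[i]]_2) i 0 = v i 0.
  by rewrite -[RHS](row_mxEl v w); congr (row_mx v w i _); exact: val_inj.
have e1 i : (row_mx v w : 'M[R[i]]_2) i 1 = w i 0.
  by rewrite -[RHS](row_mxEr v w); congr (row_mx v w i _); exact: val_inj.
rewrite (expand_det_row _ 0) sum_ord2 e0 e1 /cofactor !det_mx11.
have rE (i j : 'I_2) (A : 'M[R[i]]_2) :
    row' i (col' j A) 0 0 = A (lift i 0) (lift j 0) by rewrite !mxE.
rewrite !rE.
rewrite (_ : lift 0 0 = 1 :> 'I_2); last exact: val_inj.
rewrite (_ : lift 1 0 = 0 :> 'I_2); last exact: val_inj.
by rewrite e0 e1 /= expr0 expr1; ring.
Qed.

Lemma unit_vector_line (V : {vspace 'cV[R[i]]_2}) : \dim V = 1%N ->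
  exists u, [/\ u \in V, enorm u = 1 & forall v, v \in V -> exists k, v = k *: u].
Proof.
move=> dV; set v := vpick V.
have v0 : v != 0 by rewrite vpick0; apply/eqP => V0; move: dV; rewrite V0 dimv0.
have nv : 0 < enorm v by apply: enorm_gt0.
have k0 : ((enorm v)^-1)%:C != 0 :> R[i].
  by rewrite -normc_gt0 normc_real normr_gt0 invr_eq0 gt_eqF.
exists (((enorm v)^-1)%:C *: v); split.
- by rewrite memvZ// memv_pick.
- by rewrite enormZ normc_real ger0_norm ?invr_ge0 ?(ltW nv)// mulVf// gt_eqF.
- move=> w wV; have VE : (<[v]> = V)%VS.
    by apply/eqP; rewrite eqEdim -memvE memv_pick dV dim_vline v0.
  have : w \in <[v]>%VS by rewrite VE.
  case/vlineP => k ->; exists (k / ((enorm v)^-1)%:C).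
  by rewrite scalerA divfK.
Qed.

Lemma jacobi_cocycle_mul0 a b E j v : (@jacobi_cocycle R a b E j *m v) 0 0 =
  (E - (b j)%:C) * v 0 0 - (a (j - 1))^* * v 1 0.
Proof. by rewrite mxE sum_ord2 !mxE/= mulNr. Qed.

Lemma jacobi_cocycle_mul1 a b E j v : (@jacobi_cocycle R a b E j *m v) 1 0 = a j * v 0 0.
Proof. by rewrite mxE sum_ord2 !mxE/= mul0r addr0. Qed.

Lemma iter_cocycle_eigen (B : int -> 'M[R[i]]_2) (u : int -> 'cV[R[i]]_2)
    (mu : int -> R[i]) :
  (forall j, B j *m u j = mu j *: u (j + 1)) ->
  forall n j, iter_cocycle B n j *m u j = (\prod_(i < n) mu (j + i%:Z)) *: u (j + n%:Z).
Proof.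
move=> Bu n j; elim: n => [|n IH]; first by rewrite mul1mx big_ord0 scale1r addr0.
rewrite /= -mulmxA IH -scalemxAr Bu scalerA big_ord_recr/=; congr (_ *: u _); lia.
Qed.

(** Cramer's rule. *)
Lemma det_decomposition (u s v : 'cV[R[i]]_2) : u 0 0 * s 1 0 - u 1 0 * s 0 0 != 0 ->
  v = ((v 0 0 * s 1 0 - v 1 0 * s 0 0) / (u 0 0 * s 1 0 - u 1 0 * s 0 0)) *: u +
      ((u 0 0 * v 1 0 - u 1 0 * v 0 0) / (u 0 0 * s 1 0 - u 1 0 * s 0 0)) *: s.
Proof.
by move=> D0; apply: cV2_eqP; rewrite !mxE; field.
Qed.

Lemma normc_det_le v w : normc (v 0 0 * w 1 0 - v 1 0 * w 0 0) <= 2 * enorm v * enorm w.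
Proof.
apply: (le_trans (le_normcB _ _)); rewrite !normcM -mulrA mulr_natl mulr2n.
by rewrite lerD// ler_pM ?normc_ge0 ?normc_le_enorm.
Qed.

End plane.

Lemma bounded_norm (R : realType) (b : int -> R) :
  bounded_fun (b : int -> R^o) -> exists M, forall n, `|b n| <= M.
Proof.
by case=> M [_ hM]; exists (M + 1) => n; apply: (hM _ (ltr_pwDr ltr01 (lexx M)) n I).
Qed.

(** * Bounded frames from a dominated splitting *)

Section splitting_resolvent.
Context {R : realType} (a : int -> R[i]) (b : int -> R).
Context (ha : bounded_fun (a : int -> R[i]^o)) (hb : bounded_fun (b : int -> R^o)).
Variable E : R[i].

Lemma jacobi_cocycle_bound : exists2 M : R, 0 < M &
  forall j (v : 'cV[R[i]]_2), enorm (jacobi_cocycle a b E j *m v) <= M * enorm v.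
Proof.
have [Ma hMa] := bounded_normc ha.
have [Mb hMb] := bounded_norm hb.
have Ma0 : 0 <= Ma by rewrite (le_trans _ (hMa 0))// normc_ge0.
have Mb0 : 0 <= Mb by rewrite (le_trans _ (hMb 0)).
exists (normc E + Mb + Ma + Ma + 1) => [|j v].
  by rewrite ltr_wpDl// !addr_ge0// normc_ge0.
apply: (le_trans (enorm_le_add _)); rewrite jacobi_cocycle_mul0 jacobi_cocycle_mul1.
have hE : normc (E - (b j)%:C) <= normc E + Mb.
  by apply: (le_trans (le_normcB _ _)); rewrite lerD2l normc_real.
have h0 : normc ((E - (b j)%:C) * v 0 0) <= (normc E + Mb) * enorm v.
  by rewrite normcM ler_pM ?normc_ge0// normc_le_enorm.
have h1 : normc ((a (j - 1))^* * v 1 0) <= Ma * enorm v.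
  by rewrite normcM normc_conj ler_pM ?normc_ge0// normc_le_enorm.
have h2 : normc (a j * v 0 0) <= Ma * enorm v.
  by rewrite normcM ler_pM ?normc_ge0// normc_le_enorm.
have := le_normcB ((E - (b j)%:C) * v 0 0) ((a (j - 1))^* * v 1 0).
have := enorm_ge0 v; rewrite !mulrDl mul1r; rewrite !mulrDl in h0; lra.
Qed.

Lemma opnorm_witness (A : 'M[R[i]]_2) (c : R) : 0 < c -> c <= opnorm A ->
  exists2 v, enorm v = 1 & c / 2 < enorm (A *m v).
Proof.
(* A set without supremum gets [sup] equal to 0, which the positive lower bound excludes. *)
move=> c0 cA; have hs : has_sup [set enorm (A *m v) | v in [set v | enorm v = 1]].
  apply: contrapT => /sup_out h.
  by move: (lt_le_trans c0 cA); rewrite /opnorm h ltxx.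
have c2 : 0 < c / 2 by rewrite divr_gt0.
have [_ [v v1 <-] h] := sup_adherent c2 hs.
exists v => //; apply: le_lt_trans h; move: cA; rewrite /opnorm; lra.
Qed.

(** Unit vectors in the two lines serve as frames. The delicate bound is that of [mu] away from 0,
    which comes from the lower bound on the norm of the [N]-step cocycle. *)
Lemma dominated_splitting_resolvent :
  dominated_splitting (jacobi_cocycle a b E) ->
  boundedly_invertible (fun v => jacobi ha hb v - E *: v).
Proof.
case=> _ [Eu [Es [dims [N [lambda [delta [[N0 l1 d0] [inv dom ang low]]]]]]]].
set B := jacobi_cocycle a b E in inv dom low *.
have [M M0 BM] := jacobi_cocycle_bound.
have /choice[u hu] j := unit_vector_line (proj1 (dims j)).
have /choice[s hs] j := unit_vector_line (proj2 (dims j)).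
have uE j : u j \in Eu j by case: (hu j).
have sE j : s j \in Es j by case: (hs j).
have u1 j : enorm (u j) = 1 by case: (hu j).
have s1 j : enorm (s j) = 1 by case: (hs j).
have /choice[mu Bu] j : exists k, B j *m u j = k *: u (j + 1).
  by case: (hu (j + 1)) => _ _; apply; apply: (proj1 (inv j)).
have /choice[nu Bs] j : exists k, B j *m s j = k *: s (j + 1).
  by case: (hs (j + 1)) => _ _; apply; apply: (proj2 (inv j)).
pose D j := u j 0 0 * s j 1 0 - u j 1 0 * s j 0 0.
have n0 (v : 'cV[R[i]]_2) : enorm v = 1 -> v != 0.
  move=> v1; apply/eqP => v0; have := enormZ 0 v.
  by rewrite scale0r v0 -v0 v1 normc0 mul0r => /eqP; rewrite oner_eq0.
have dD j : delta / 2 < normc (D j).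
  have := ang j; rewrite (line_distE (proj1 (dims j)) (proj2 (dims j)) (uE j) (n0 _ (u1 j))
    (sE j) (n0 _ (s1 j))) /vec_dist u1 s1 mulr1 divr1 det_row_cV2 -/(D j).
  by rewrite ltr_pdivrMr// mulrC.
have mE j : normc (mu j) = enorm (B j *m u j) by rewrite Bu enormZ u1 mulr1.
have muM j : normc (mu j) <= M by rewrite mE (le_trans (BM _ _))// u1 mulr1.
have BuN j : enorm (iter_cocycle B N j *m u j) = \prod_(i < N) normc (mu (j + i%:Z)).
  by rewrite (iter_cocycle_eigen Bu) enormZ u1 mulr1 normc_prod.
have BsN j : enorm (iter_cocycle B N j *m s j) = \prod_(i < N) normc (nu (j + i%:Z)).
  by rewrite (iter_cocycle_eigen Bs) enormZ s1 mulr1 normc_prod.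
have domN j : lambda * \prod_(i < N) normc (nu (j + i%:Z)) <=
              \prod_(i < N) normc (mu (j + i%:Z)).
  by rewrite -BuN -BsN ltW// dom.
set c0 := inf _ in low.
have lowN j : c0 <= opnorm (iter_cocycle B N j).
  apply: ge_inf; last by exists j.
  (* Without a lower bound the infimum would take the default value 0. *)
  apply: contrapT => nlb; have : c0 = 0 by apply: inf_out => -[].
  by move=> c00; rewrite c00 ltxx in low.
(* A unit vector [v] with image longer than [c0 / 2] has frame coefficients at most [4 / delta]. The
   image of [s j] is no longer than that of [u j], so each component of the image of [v] is at most
   [8 / delta] times the length of the image of [u j]. *)
have prodN j : c0 * delta / 32 <= \prod_(i < N) normc (mu (j + i%:Z)).
  have [v v1 hv] := opnorm_witness low (lowN j).
  rewrite -BuN; set A := iter_cocycle B N j in hv *.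
  have D0 : D j != 0 by rewrite -normc_gt0 (lt_trans _ (dD j))// divr_gt0.
  have Ds : enorm (A *m s j) <= enorm (A *m u j).
    apply: ltW; apply: le_lt_trans (dom j _ _ (uE j) (sE j) (u1 j) (s1 j)).
    by rewrite ler_peMl ?enorm_ge0// ltW.
  have vE := det_decomposition v D0.
  have coef (w w' : 'cV[R[i]]_2) : enorm w = 1 -> enorm w' = 1 ->
      normc ((w 0 0 * w' 1 0 - w 1 0 * w' 0 0) / D j) <= 4 / delta.
    move=> w1 w1'; rewrite normcM normcV.
    have := normc_det_le w w'; rewrite w1 w1' !mulr1 => h.
    rewrite (_ : 4 / delta = 2 * (delta / 2)^-1); last by field; rewrite gt_eqF.
    rewrite ler_pM ?normc_ge0// ?invr_ge0 ?normc_ge0//.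
    by rewrite lef_pV2 ?posrE ?divr_gt0 ?normc_gt0// ltW.
  have cx := coef _ _ v1 (s1 j); have cy := coef _ _ (u1 j) v1.
  have comp i : normc ((A *m v) i 0) <= 8 / delta * enorm (A *m u j).
    have ZE k (w : 'cV[R[i]]_2) : (k *: w) i 0 = k * w i 0 by rewrite mxE.
    rewrite vE mulmxDr -!scalemxAr mxE !ZE.
    apply: (le_trans (le_normcD _ _)).
    rewrite (_ : 8 / delta = 4 / delta + 4 / delta); last by ring.
    rewrite [leRHS]mulrDl; apply: lerD; rewrite normcM; apply: ler_pM; rewrite ?normc_ge0//.
      exact: normc_le_enorm.
    exact: le_trans (normc_le_enorm _ _) Ds.
  have h := enorm_le_add (A *m v); have h0 := comp 0; have h1 := comp 1.
  have : c0 / 2 <= 16 / delta * enorm (A *m u j).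
    rewrite (_ : 16 / delta = 8 / delta + 8 / delta) ?mulrDl; last by ring.
    lra.
  move=> h16; rewrite (_ : c0 * delta / 32 = c0 / 2 * (delta / 16)); last by field.
  have d16 : 0 <= delta / 16 by rewrite divr_ge0// ltW.
  apply: (le_trans (ler_wpM2r d16 h16)).
  rewrite le_eqVlt; apply/orP; left; apply/eqP.
  by field; rewrite gt_eqF.
have c1 : 0 < c0 * delta / 32 by rewrite !mulr_gt0// invr_gt0.
(* The remaining [N - 1] factors of the product are at most [M] each. *)
have cmu j : c0 * delta / 32 / M ^+ N.-1 <= normc (mu j).
  rewrite ler_pdivrMr ?exprn_gt0//; apply: (le_trans (prodN j)).
  case: N N0 {dom BuN BsN domN prodN c0 low lowN c1} => // N _.
  rewrite big_ord_recl/= addr0 ler_wpM2l ?normc_ge0//.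
  rewrite -[X in _ ^+ X](card_ord N) -prodr_const.
  by apply: ler_prod => i _; rewrite normc_ge0 muM.
apply: (@frames_boundedly_invertible _ _ _ ha hb E (fun n => u n 0 0) (fun n => u n 1 0)
  (fun n => s n 0 0) (fun n => s n 1 0) mu nu N lambda
  (c0 * delta / 32 / M ^+ N.-1) (delta / 2) M) => //.
- by rewrite divr_gt0 ?exprn_gt0.
- by rewrite divr_gt0.
- by move=> n; split; [rewrite -(u1 n)|rewrite -(u1 n)|rewrite -(s1 n)|rewrite -(s1 n)];
    exact: normc_le_enorm.
- by move=> n; rewrite -jacobi_cocycle_mul0 -/B Bu mxE.
- by move=> n; rewrite -(jacobi_cocycle_mul1 a b E) -/B Bu mxE.
- by move=> n; rewrite -jacobi_cocycle_mul0 -/B Bs mxE.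
- by move=> n; rewrite -(jacobi_cocycle_mul1 a b E) -/B Bs mxE.
- by move=> n; rewrite ltW// dD.
- by move=> n; rewrite cmu muM.
Qed.

End splitting_resolvent.

(** * From the resolvent to dominated splitting *)

Section half_line_solutions.
Context {R : realType} (a : int -> R[i]) (b : int -> R).
Variable E : R[i].
Implicit Types (psi phi g : l2 R) (j m n k : int).

Definition jacobi_eqn (f : int -> R[i]) n : R[i] :=
  (a (n - 1))^* * f (n - 1) + a n * f (n + 1) - (E - (b n)%:C) * f n.

(** No equation is imposed at [j], because it involves the value at [j + 1], which is cut off. *)
Definition left_solution j psi :=
  (forall n, j < n -> psi n = 0) /\ (forall n, n < j -> jacobi_eqn psi n = 0).

(* [y] plays the role of the value at [j - 1], which enters only through the
   equation at [j]; it is not determined by [psi] when [a (j - 1) = 0]. *)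
Definition right_solution j (y : R[i]) psi :=
  [/\ forall n, n < j -> psi n = 0, forall n, j < n -> jacobi_eqn psi n = 0 &
      jacobi_eqn psi j = - ((a (j - 1))^* * y)].

Lemma left_solution_eqn j psi n : left_solution j psi ->
  jacobi_eqn psi n = (n == j)%:R * jacobi_eqn psi j +
                     (n == j + 1)%:R * ((a j)^* * psi j).
Proof.
move=> [sup sol]; have [nj|jn|->] := ltgtP n j.
- by rewrite sol// (_ : n == j + 1 = false) ?mul0r ?addr0//; lia.
- have [->|nj1] := eqVneq n (j + 1).
    by rewrite mul0r mul1r add0r /jacobi_eqn addrK [psi (j + 1 + 1)]sup ?[psi (j + 1)]sup;
      rewrite ?mulr0 ?subr0 ?addr0//; lia.
  by rewrite !mul0r addr0 /jacobi_eqn !sup ?mulr0 ?addr0 ?subr0//; lia.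
- by rewrite (_ : j == j + 1 = false) ?mul1r ?mul0r ?addr0//; lia.
Qed.

Lemma right_solution_eqn j y psi n : right_solution j y psi ->
  jacobi_eqn psi n = (n == j - 1)%:R * (a (j - 1) * psi j) +
                     (n == j)%:R * - ((a (j - 1))^* * y).
Proof.
move=> [sup sol solj]; have [nj|jn|->] := ltgtP n j.
- have [->|nj1] := eqVneq n (j - 1).
    by rewrite mul0r mul1r addr0 /jacobi_eqn subrK [psi (j - 1 - 1)]sup ?[psi (j - 1)]sup;
      rewrite ?mulr0 ?subr0 ?add0r//; lia.
  by rewrite !mul0r addr0 /jacobi_eqn !sup ?mulr0 ?addr0 ?subr0//; lia.
- by rewrite sol// (_ : n == j - 1 = false) ?mul0r ?addr0//; lia.
- by rewrite (_ : j == j - 1 = false) ?mul1r ?mul0r ?add0r//; lia.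
Qed.

Lemma left_solution_cut j k psi : left_solution j psi -> k <= j ->
  exists phi, left_solution k phi /\ forall n, n <= k -> phi n = psi n.
Proof.
move=> [sup sol] kj; have [->|kj'] := eqVneq k j; first by exists psi.
have e n : n <= k -> (psi - l2_cut (k + 1) psi) n = psi n.
  by move=> nk; rewrite l2_subE l2_cutE ifF ?subr0//; lia.
exists (psi - l2_cut (k + 1) psi); split=> //; split => n nk.
  by rewrite l2_subE l2_cutE ifT ?subrr//; lia.
by rewrite -[RHS](sol n) ?/jacobi_eqn ?e//; lia.
Qed.

Lemma right_solution_cut j y k psi : right_solution j y psi -> j < k ->
  exists phi, right_solution k (psi (k - 1)) phi /\ forall n, k <= n -> phi n = psi n.
Proof.
move=> [sup sol solj] jk.
have e n : k <= n -> l2_cut k psi n = psi n by move=> kn; rewrite l2_cutE kn.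
have e0 n : n < k -> l2_cut k psi n = 0 by move=> kn; rewrite l2_cutE ifF//; lia.
exists (l2_cut k psi); split=> //; split => [n nk|n nk|].
- exact: e0.
- by rewrite -[RHS](sol n) ?/jacobi_eqn ?e//; lia.
- have := sol k jk; rewrite /jacobi_eqn e0 ?e//; try lia.
  by rewrite mulr0 add0r -addrA => /eqP; rewrite addr_eq0 => /eqP ->; rewrite opprK.
Qed.

(** Scaling by [a j] avoids dividing by it: the value added at [j + 1] makes the equation hold at
    [j], and the data at [j + 1] are the cocycle applied to the data at [j]. *)
Lemma left_solution_step j psi : left_solution j psi ->
  exists phi, left_solution (j + 1) phi /\
    [/\ phi (j + 1) = (E - (b j)%:C) * psi j - (a (j - 1))^* * psi (j - 1) &
        forall n, n <= j -> phi n = a j * psi n].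
Proof.
move=> [sup sol].
pose t := (E - (b j)%:C) * psi j - (a (j - 1))^* * psi (j - 1).
have phiE n : (a j *: psi + t *: l2_delta (j + 1)) n = a j * psi n + t * (n == j + 1)%:R.
  by rewrite l2_addE !l2_scaleE l2_deltaE.
have e n : n <= j -> (a j *: psi + t *: l2_delta (j + 1)) n = a j * psi n.
  by move=> nj; rewrite phiE (_ : n == j + 1 = false) ?mulr0 ?addr0//; clear -nj; lia.
have e1 : (a j *: psi + t *: l2_delta (j + 1)) (j + 1) = t.
  by rewrite phiE eqxx mulr1 sup ?mulr0 ?add0r//; lia.
exists (a j *: psi + t *: l2_delta (j + 1)); split=> //; split => n nj.
  have nj1 : (n == j + 1) = false by clear -nj; lia.
  by rewrite phiE nj1 sup ?mulr0 ?addr0//; clear -nj; lia.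
have nj0 : n <= j by clear -nj; lia.
have nj1 : n - 1 <= j by clear -nj; lia.
have [nE|nj'] := eqVneq n j.
  by rewrite nE in nj1 *; rewrite /jacobi_eqn e1 !e// /t; ring.
have nj2 : n < j by clear -nj0 nj'; lia.
have nj3 : n + 1 <= j by clear -nj2; lia.
rewrite /jacobi_eqn !e//.
transitivity (a j * jacobi_eqn psi n); first by rewrite /jacobi_eqn; ring.
by rewrite sol ?mulr0.
Qed.

Lemma right_solution_step j y psi : right_solution j y psi ->
  exists phi, right_solution (j + 1) (a j * psi j) phi /\
    forall n, j < n -> phi n = a j * psi n.
Proof.
move=> hpsi; have [|phi [[sup sol solj] e]] := right_solution_cut (k := j + 1) hpsi; first lia.
have scaleE n : jacobi_eqn (a j *: phi) n = a j * jacobi_eqn phi n.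
  by rewrite /jacobi_eqn !l2_scaleE; ring.
exists (a j *: phi); split; first split => [n nj|n nj|].
- by rewrite l2_scaleE sup ?mulr0.
- by rewrite scaleE sol ?mulr0.
- by rewrite scaleE solj addrK mulrN; congr (- _); ring.
- by move=> n jn; rewrite l2_scaleE e//; lia.
Qed.

(** This is the equation at [j] with [y] as the value at [j - 1]. *)
Lemma right_solution_next j y psi : right_solution j y psi ->
  (E - (b j)%:C) * psi j - (a (j - 1))^* * y = a j * psi (j + 1).
Proof.
move=> [sup sol]; rewrite /jacobi_eqn [psi (j - 1)]sup; last lia.
rewrite mulr0 add0r => /eqP; rewrite -addr_eq0 => /eqP h.
by apply/eqP; rewrite -subr_eq0 -oppr_eq0; apply/eqP; rewrite -[RHS]h; ring.
Qed.

End half_line_solutions.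

(** * Decay, transversality and existence of half-line solutions *)

Section invertible_jacobi.
Context {R : realType} (a : int -> R[i]) (b : int -> R).
Context (ha : bounded_fun (a : int -> R[i]^o)) (hb : bounded_fun (b : int -> R^o)).
Variables (E : R[i]) (K M : R).
Hypotheses (K0 : 0 < K) (M0 : 0 < M).
Hypothesis (aM : forall n, normc (a n) <= M).
Hypothesis (bM : forall n, normc (E - (b n)%:C) <= M).
Hypothesis (TK : forall psi : l2 R,
  seqnorm psi <= K * seqnorm (jacobi ha hb psi - E *: psi)).
Hypothesis (Tsurj : forall g : l2 R, exists psi, jacobi ha hb psi - E *: psi = g).
Implicit Types (psi phi g : l2 R) (j m n k : int).

Let eqn := jacobi_eqn a b E.
Let left := left_solution a b E.
Let right := right_solution a b E.

(** Meant for cut-off solutions, whose defects sit at two neighbouring sites. *)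
Lemma two_point_bound psi m (x y : R[i]) :
  (forall n, eqn psi n = (n == m)%:R * x + (n == m + 1)%:R * y) ->
  seqnorm psi <= K * (normc x + normc y).
Proof.
move=> h; apply: (le_trans (TK psi)); rewrite ler_wpM2l ?(ltW K0)//.
have -> : jacobi ha hb psi - E *: psi = x *: l2_delta m + y *: l2_delta (m + 1).
  apply: l2_eqP => n; rewrite jacobi_subE l2_addE !l2_scaleE !l2_deltaE.
  by rewrite -/(jacobi_eqn a b E psi n) [LHS]h; congr (_ + _); rewrite mulrC.
apply: (le_trans (seqnormD _ _)); rewrite !seqnormZ.
by rewrite lerD// ler_piMr ?normc_ge0// seqnorm_delta.
Qed.

Lemma right_solution_bound j y psi : right j y psi ->
  seqnorm psi <= K * M * (normc (psi j) + normc y).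
Proof.
move=> hpsi; have h n := right_solution_eqn n hpsi.
have := @two_point_bound psi (j - 1) (a (j - 1) * psi j) (- ((a (j - 1))^* * y)).
rewrite subrK => /(_ h) /le_trans; apply.
rewrite -mulrA ler_wpM2l ?(ltW K0)// mulrDr normcN !normcM normc_conj.
by rewrite lerD// ler_wpM2r ?normc_ge0.
Qed.

(** Up to sign and conjugation of [a j], the two defects are the components of the cocycle applied
    to the data at [j]. This form later yields expansion on the unstable bundle. *)
Lemma left_solution_bound_step j psi : left j psi -> seqnorm psi <=
  K * (normc ((E - (b j)%:C) * psi j - (a (j - 1))^* * psi (j - 1)) + normc (a j * psi j)).
Proof.
move=> hpsi; have h n := left_solution_eqn n hpsi.
have := two_point_bound h; rewrite !normcM normc_conj -[normc (jacobi_eqn _ _ _ _ _)]normcN.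
congr (_ <= K * (normc _ + _)); rewrite /jacobi_eqn.
have -> : psi (j + 1) = 0 by case: hpsi => sup _; rewrite sup//; clear; lia.
by rewrite mulr0 addr0 opprB.
Qed.

Lemma left_solution_bound j psi : left j psi ->
  seqnorm psi <= 2 * K * M * (normc (psi j) + normc (psi (j - 1))).
Proof.
move=> /left_solution_bound_step /le_trans; apply.
rewrite (_ : 2 * K * M * _ = K * (M * normc (psi j) + M * normc (psi (j - 1)) +
  (M * normc (psi j) + M * normc (psi (j - 1))))); last by ring.
rewrite ler_wpM2l ?(ltW K0)//; apply: lerD.
  apply: (le_trans (le_normcB _ _)); rewrite !normcM normc_conj.
  by rewrite lerD// ler_wpM2r ?normc_ge0.
rewrite normcM ler_wpDr ?mulr_ge0 ?normc_ge0 ?(ltW M0)//.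
by rewrite ler_wpM2r ?normc_ge0.
Qed.

Lemma window_sum_le psi k (N : nat) :
  \sum_(i < N) normc (psi (k + i%:Z)) ^+ 2 <= seqnorm psi ^+ 2.
Proof.
have := @seqnorm_sum _ psi [seq k + i%:Z | i <- iota 0 N] (l2valP psi).
rewrite map_inj_uniq; last by move=> x y /addrI[].
by rewrite iota_uniq => /(_ isT); rewrite big_map -[N in iota 0 N]subn0 big_mkord.
Qed.

(** Summed over the window, each site is met at most twice, hence the factor 2. *)
Lemma window_average psi phi k (N : nat) (x C : R) : 0 <= C ->
  (forall i : nat, (i < N)%N -> x <= C *
    (normc (psi (k + i%:Z)) ^+ 2 + normc (psi (k + i%:Z + 1)) ^+ 2 +
     (normc (phi (k + i%:Z)) ^+ 2 + normc (phi (k + i%:Z + 1)) ^+ 2))) ->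
  N%:R * x <= 2 * C * (seqnorm psi ^+ 2 + seqnorm phi ^+ 2).
Proof.
move=> C0 h.
have : \sum_(i < N) x <= \sum_(i < N) (C *
    (normc (psi (k + i%:Z)) ^+ 2 + normc (psi (k + i%:Z + 1)) ^+ 2 +
     (normc (phi (k + i%:Z)) ^+ 2 + normc (phi (k + i%:Z + 1)) ^+ 2))).
  by apply: ler_sum => i _; exact: h.
rewrite sumr_const card_ord mulr_natl => /le_trans; apply.
rewrite -mulr_sumr !big_split/=.
have s1 (f : l2 R) : \sum_(i < N) normc (f (k + i%:Z + 1)) ^+ 2 <= seqnorm f ^+ 2.
  have := window_sum_le f (k + 1) N; congr (_ <= _).
  by apply: eq_bigr => i _; rewrite addrAC.
have := window_sum_le psi k N; have := window_sum_le phi k N.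
have := s1 psi; have := s1 phi => h1 h2 h3 h4.
rewrite (_ : 2 * C * _ = C * (seqnorm psi ^+ 2 + seqnorm psi ^+ 2 +
  (seqnorm phi ^+ 2 + seqnorm phi ^+ 2))); last by ring.
by rewrite ler_wpM2l// !lerD.
Qed.

(** The sum of squares is repeated to match [window_average] with both sequences equal. *)
Lemma sqr_add_le (x y z C : R) : 0 <= z -> z <= C * (x + y) ->
  z ^+ 2 <= C ^+ 2 * (x ^+ 2 + y ^+ 2 + (x ^+ 2 + y ^+ 2)).
Proof.
move=> z0 zC; apply: (@le_trans _ _ ((C * (x + y)) ^+ 2)).
  by rewrite ler_pXn2r ?nnegrE// (le_trans z0).
rewrite exprMn ler_wpM2l ?sqr_ge0//; have := sqr_ge0 (x - y); rewrite sqrrB sqrrD; lra.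
Qed.

Let C := 2 * K * M.

Lemma C_ge0 : 0 <= C. Proof. by rewrite !mulr_ge0// ltW. Qed.

Lemma right_solution_bound2 j y psi : right j y psi ->
  seqnorm psi <= C * (normc (psi j) + normc y).
Proof.
move=> /right_solution_bound /le_trans; apply.
rewrite ler_wpM2r ?addr_ge0 ?normc_ge0// /C -mulrA ler_peMl ?mulr_ge0 ?ltW//.
by rewrite ltr1n.
Qed.

(** A value [x] controlled by the data at each of [m] sites gains a factor [1 / m] in its square on
    averaging. This polynomial rate suffices, since domination asks only for one large [m]. *)
Lemma solution_decay (x s : R) psi k (m : nat) : 0 <= s ->
  (forall i : nat, (i < m)%N -> x ^+ 2 <= C ^+ 2 *
    (normc (psi (k + i%:Z)) ^+ 2 + normc (psi (k + i%:Z + 1)) ^+ 2 +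
     (normc (psi (k + i%:Z)) ^+ 2 + normc (psi (k + i%:Z + 1)) ^+ 2))) ->
  seqnorm psi <= C * s -> m%:R * x ^+ 2 <= (2 * C ^+ 2 * s) ^+ 2.
Proof.
move=> s0 h psis; apply: (le_trans (window_average (sqr_ge0 C) h)).
rewrite (_ : (2 * C ^+ 2 * s) ^+ 2 = 2 * C ^+ 2 * ((C * s) ^+ 2 + (C * s) ^+ 2)); last by ring.
have sqle : seqnorm psi ^+ 2 <= (C * s) ^+ 2.
  by rewrite ler_pXn2r ?nnegrE ?seqnorm_ge0// mulr_ge0// C_ge0.
by apply: ler_wpM2l; [rewrite mulr_ge0 ?sqr_ge0|exact: lerD].
Qed.

(** Cutting at each site between [j + 1] and [j + m] bounds the value at [j + m] by the data at the
    cut. *)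
Lemma right_solution_decay j y psi (m : nat) : right j y psi ->
  m%:R * normc (psi (j + m%:Z)) ^+ 2 <= (2 * C ^+ 2 * (normc (psi j) + normc y)) ^+ 2.
Proof.
move=> hpsi; apply: (@solution_decay _ _ psi j); last exact: right_solution_bound2.
  by rewrite addr_ge0 ?normc_ge0.
move=> i im; have jk : j < j + i%:Z + 1 by clear; lia.
have [phi [hphi phiE]] := right_solution_cut hpsi jk.
have jm : j + i%:Z + 1 <= j + m%:Z by clear -im; lia.
rewrite ![normc (psi (j + i)) ^+ 2 + _]addrC.
apply: sqr_add_le; first exact: normc_ge0.
rewrite -phiE// -[psi (j + i + 1)]phiE//.
apply: (le_trans (normc_le_seqnorm _ _)); apply: (le_trans (right_solution_bound2 hphi)).
by rewrite addrK.
Qed.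

Lemma left_solution_decay j psi (m : nat) : left j psi ->
  m%:R * normc (psi (j - m%:Z)) ^+ 2 <=
    (2 * C ^+ 2 * (normc (psi j) + normc (psi (j - 1)))) ^+ 2.
Proof.
(* The window starts at [j - m - 1], so that its pairs are the data at the cuts [j - m], ...,
   [j - 1]. *)
move=> hpsi; apply: (@solution_decay _ _ psi (j - m%:Z - 1)); last exact: left_solution_bound.
  by rewrite addr_ge0 ?normc_ge0.
move=> i im; have jk : j - m%:Z - 1 + i%:Z + 1 <= j by clear -im; lia.
have [phi [hphi phiE]] := left_solution_cut hpsi jk.
have jm : j - m%:Z <= j - m%:Z - 1 + i%:Z + 1 by clear; lia.
have jm1 : j - m%:Z - 1 + i%:Z <= j - m%:Z - 1 + i%:Z + 1 by clear; lia.
rewrite ![normc (psi (j - m%:Z - 1 + i%:Z)) ^+ 2 + _]addrC.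
apply: sqr_add_le; first exact: normc_ge0.
rewrite -phiE// -[psi (_ + 1)]phiE// -[psi (j - m%:Z - 1 + i%:Z)]phiE//.
apply: (le_trans (normc_le_seqnorm _ _)); apply: (le_trans (left_solution_bound hphi)).
by rewrite addrK.
Qed.

(** One step conjugates the weight of the Wronskian, so only the modulus of the weighted Wronskian
    is constant. *)
Lemma wronskian_step psi phi n : eqn psi n = 0 -> eqn phi n = 0 ->
  a n * (psi (n + 1) * phi n - psi n * phi (n + 1)) =
  (a (n - 1))^* * (psi n * phi (n - 1) - psi (n - 1) * phi n).
Proof.
move=> hpsi hphi; apply/eqP; rewrite -subr_eq0; apply/eqP.
transitivity (eqn psi n * phi n - eqn phi n * psi n).
  by rewrite /eqn /jacobi_eqn; ring.
by rewrite hpsi hphi !mul0r subr0.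
Qed.

Lemma wronskian_le psi phi n (z : R[i]) :
  normc z = normc (a n * (psi (n + 1) * phi n - psi n * phi (n + 1))) ->
  normc z <= M * (normc (psi n) ^+ 2 + normc (psi (n + 1)) ^+ 2 +
                  (normc (phi n) ^+ 2 + normc (phi (n + 1)) ^+ 2)).
Proof.
move=> ->; rewrite normcM ler_pM ?normc_ge0//.
apply: (le_trans (le_normcB _ _)); rewrite !normcM.
have h (x y : R) : x * y <= x ^+ 2 + y ^+ 2.
  by have := sqr_ge0 (x - y); have := sqr_ge0 (x + y); rewrite sqrrB sqrrD; lra.
have := h (normc (psi (n + 1))) (normc (phi n)).
have := h (normc (psi n)) (normc (phi (n + 1))); lra.
Qed.

Lemma eq0_of_average (z : R[i]) (x : R) :
  (forall N : nat, N%:R * normc z <= x) -> z = 0.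
Proof.
move=> h; apply: eq0_normc; apply/eqP; rewrite eq_le normc_ge0 andbT.
rewrite leNgt; apply/negP => z0.
have := h (Num.truncn `|x / normc z|).+1; rewrite -ler_pdivlMr// leNgt => /negP; apply.
by apply: (le_lt_trans (ler_norm _)); exact: truncnS_gt.
Qed.

(** The weighted Wronskian has constant modulus [normc (a (j - 1))] and is summable, so
    [a (j - 1) = 0]. Then [phi], cut at [j], has no defect and must vanish. *)
Lemma left_solutions_dependent j psi phi : left j psi -> left j phi ->
  psi j = 1 -> psi (j - 1) = 0 -> phi j = 0 -> phi (j - 1) = 1 -> False.
Proof.
move=> hpsi hphi psi1 psi0 phi0 phi1.
have W (i : nat) : normc (a (j - 1)) = normc (a (j - 1 - i%:Z) *
    (psi (j - 1 - i%:Z + 1) * phi (j - 1 - i%:Z) - psi (j - 1 - i%:Z) * phi (j - 1 - i%:Z + 1))).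
  elim: i => [|i IH]; first by rewrite subr0 subrK psi1 phi1 phi0 mulr0 subr0 !mulr1.
  rewrite IH wronskian_step; last 2 first.
  - by case: hpsi => _; apply; clear; lia.
  - by case: hphi => _; apply; clear; lia.
  have -> : j - 1 - i.+1%:Z = j - 1 - i%:Z - 1 by clear; lia.
  by rewrite !normcM normc_conj subrK.
have a0 : a (j - 1) = 0.
  apply: (@eq0_of_average _ (2 * M * (seqnorm psi ^+ 2 + seqnorm phi ^+ 2))) => N.
  apply: (@window_average _ _ (j - N%:Z)) => [|i iN]; first exact: ltW.
  apply: wronskian_le; rewrite (W (N - i.+1)%N).
  by have -> : j - 1 - (N - i.+1)%N%:Z = j - N%:Z + i%:Z by clear -iN; lia.
have := left_solution_bound_step hphi.
rewrite phi0 phi1 a0 rmorph0 !mul0r !mulr0 subrr normc0 addr0 mulr0 => h.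
have /seqnorm_eq0 phiE : seqnorm phi = 0 by apply/eqP; rewrite eq_le h seqnorm_ge0.
by move: phi1; rewrite phiE l2_0E => /esym/eqP; rewrite oner_eq0.
Qed.

(** As on the left, the Wronskian forces [a (j - 1) = 0]; then [psi] has no defect and must
    vanish. *)
Lemma right_solutions_dependent j psi phi : right j 0 psi -> right j 1 phi ->
  psi j = 1 -> phi j = 0 -> False.
Proof.
move=> hpsi hphi psi1 phi0.
have W (i : nat) : normc (a (j - 1)) = normc (a (j + i%:Z) *
    (psi (j + i%:Z + 1) * phi (j + i%:Z) - psi (j + i%:Z) * phi (j + i%:Z + 1))).
  elim: i => [|i IH].
    have := right_solution_next hphi.
    rewrite addr0 phi0 psi1 mulr0 sub0r mulr1 mulr0 sub0r mul1r mulrN => <-.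
    by rewrite opprK normc_conj.
  rewrite IH (_ : j + i.+1%:Z = j + i%:Z + 1); last by clear; lia.
  rewrite [in RHS]wronskian_step.
  - by rewrite addrK !normcM normc_conj.
  - by case: hpsi => _ + _; apply; clear; lia.
  - by case: hphi => _ + _; apply; clear; lia.
have a0 : a (j - 1) = 0.
  apply: (@eq0_of_average _ (2 * M * (seqnorm psi ^+ 2 + seqnorm phi ^+ 2))) => N.
  apply: (@window_average _ _ j) => [|i iN]; first exact: ltW.
  by apply: wronskian_le; exact: W.
have := @two_point_bound psi (j - 1) 0 0.
have h n : eqn psi n = (n == j - 1)%:R * 0 + (n == j - 1 + 1)%:R * 0.
  rewrite [LHS](right_solution_eqn n hpsi) a0 rmorph0 !mul0r oppr0 !mulr0 //.
move=> /(_ h); rewrite normc0 addr0 mulr0 => le0.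
have /seqnorm_eq0 psiE : seqnorm psi = 0 by apply/eqP; rewrite eq_le le0 seqnorm_ge0.
by move: psi1; rewrite psiE l2_0E => /esym/eqP; rewrite oner_eq0.
Qed.

(** The right-hand side of the equation for [w] is the defect created by a jump [(x, y)] of the data
    between [j - 1] and [j]. The part of [w] from [j] on is the right solution; minus its part
    before [j], completed by [x - w j] at [j], is the left one. *)
Lemma left_right_decomposition j (x y : R[i]) :
  exists psi phi z, [/\ left j psi, right j z phi,
                        x = psi j + phi j & y = psi (j - 1) + z].
Proof.
have [w hw] := Tsurj ((a (j - 1) * x) *: l2_delta (j - 1) -
                      ((a (j - 1))^* * y) *: l2_delta j).
have wE n : eqn w n = a (j - 1) * x * (n == j - 1)%:R - (a (j - 1))^* * y * (n == j)%:R.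
  rewrite /eqn /jacobi_eqn -(jacobi_subE ha hb) hw l2_subE !l2_scaleE !l2_deltaE.
  by [].
have cE n : j <= n -> l2_cut j w n = w n by move=> jn; rewrite l2_cutE jn.
have c0 n : n < j -> l2_cut j w n = 0 by move=> jn; rewrite l2_cutE leNgt jn.
pose psi := (x - w j) *: l2_delta j - (w - l2_cut j w).
have psi0 n : j < n -> psi n = 0.
  move=> jn; rewrite /psi l2_subE l2_scaleE l2_deltaE l2_subE cE ?ltW// subrr subr0.
  by rewrite gt_eqF// mulr0.
have psij : psi j = x - w j.
  by rewrite /psi l2_subE l2_scaleE l2_deltaE l2_subE cE ?lexx// subrr subr0 eqxx mulr1.
have psiE n : n < j -> psi n = - w n.
  move=> nj; rewrite /psi l2_subE l2_scaleE l2_deltaE l2_subE c0// subr0.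
  by rewrite lt_eqF// mulr0 sub0r.
have jj : j - 1 < j by clear; lia.
exists psi, (l2_cut j w), (y + w (j - 1)); split.
- split=> // n nj; have nj1 : n - 1 < j by clear -nj; lia.
  have := wE n; rewrite /eqn /jacobi_eqn (lt_eqF nj) mulr0 subr0 (psiE _ nj1) (psiE _ nj).
  have [->|nj2] := eqVneq n (j - 1).
    rewrite subrK psij mulr1 => /eqP; rewrite -subr_eq0 => /eqP h.
    by apply/eqP; rewrite -oppr_eq0; apply/eqP; rewrite -[RHS]h; ring.
  have nj3 : n + 1 < j by clear -nj nj2; lia.
  by rewrite psiE// mulr0 => h; apply/eqP; rewrite -oppr_eq0; apply/eqP; rewrite -[RHS]h; ring.
- split=> [//|n jn|].
  + have jn1 : j <= n - 1 by clear -jn; lia.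
    have jn2 : j <= n + 1 by clear -jn; lia.
    have jn3 : n == j - 1 = false by clear -jn; lia.
    by have := wE n; rewrite /eqn /jacobi_eqn !cE ?(ltW jn)// jn3 (gt_eqF jn) !mulr0 subr0.
  + have jn2 : j <= j + 1 by clear; lia.
    have jn3 : j == j - 1 = false by clear; lia.
    have := wE j; rewrite /eqn /jacobi_eqn eqxx jn3 c0// !cE// mulr0 sub0r mulr1 => h.
    rewrite mulrDr opprD -h; ring.
- by rewrite psij cE ?lexx// subrK.
- by rewrite psiE// addrCA addNr addr0.
Qed.

(** Gluing [phi] from [j] on to [- psi] before [j] gives a vector whose two defects are the
    components of the sum of the data, weighted by [a (j - 1)] up to sign and conjugation. If the
    sum is small, so are both solutions. *)
Lemma left_right_independent j psi phi z : left j psi -> right j z phi ->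
  normc (phi j) + normc z <=
  (C + 1) * (normc (psi j + phi j) + normc (psi (j - 1) + z)).
Proof.
move=> [sup sol] hphi.
pose chi := phi - (psi - psi j *: l2_delta j).
have jj : j - 1 < j by clear; lia.
have jj1 : j < j + 1 by clear; lia.
have jj2 : j - 1 == j = false by clear; lia.
pose f n := psi n - psi j * (n == j)%:R.
have fE n : n != j -> f n = psi n by move=> /negPf nj; rewrite /f nj mulr0 subr0.
have f0 n : j <= n -> f n = 0.
  rewrite le_eqVlt => /orP[/eqP <-|jn]; first by rewrite /f eqxx mulr1 subrr.
  by rewrite /f sup// gt_eqF// mulr0 subrr.
have feqn n : eqn f n = (n == j - 1)%:R * - (a (j - 1) * psi j) +
                       (n == j)%:R * ((a (j - 1))^* * psi (j - 1)).
  have [nj|jn|->] := ltgtP n j.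
  - have nj1 : n - 1 != j by clear -nj; lia.
    have nj0 : n != j by clear -nj; lia.
    have := sol n nj; rewrite /eqn /jacobi_eqn mul0r addr0 (fE _ nj1) (fE _ nj0).
    have [->|nj2] := eqVneq n (j - 1).
      by rewrite subrK f0 ?lexx// mulr0 addr0 mul1r => h;
        apply/eqP; rewrite -subr_eq0; apply/eqP; rewrite -[RHS]h; ring.
    have nj3 : n + 1 != j by clear -nj nj2; lia.
    by rewrite (fE _ nj3) mul0r.
  - have nj2 : n == j - 1 = false by clear -jn; lia.
    have nj1 : j <= n - 1 by clear -jn; lia.
    have nj3 : j <= n + 1 by clear -jn; lia.
    by rewrite nj2 /eqn /jacobi_eqn !f0 ?(ltW jn)// !mulr0 !mul0r !addr0 subr0.
  - have jn3 : j == j - 1 = false by clear; lia.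
    rewrite jn3 mul0r add0r mul1r /eqn /jacobi_eqn (f0 j) ?lexx// (f0 (j + 1)) ?(ltW jj1)//.
    by rewrite !mulr0 addr0 subr0 fE ?jj2.
have chiE n : chi n = phi n - f n.
  by rewrite /chi !l2_subE l2_scaleE l2_deltaE.
have chieqn n : eqn chi n = (n == j - 1)%:R * (a (j - 1) * (psi j + phi j)) +
    (n == j - 1 + 1)%:R * - ((a (j - 1))^* * (psi (j - 1) + z)).
  transitivity (eqn phi n - eqn f n); first by rewrite /eqn /jacobi_eqn !chiE; ring.
  by rewrite subrK feqn [eqn phi n](right_solution_eqn n hphi); ring.
have chib : seqnorm chi <= K * M * (normc (psi j + phi j) + normc (psi (j - 1) + z)).
  apply: (le_trans (two_point_bound chieqn)).
  rewrite -mulrA ler_wpM2l ?(ltW K0)// [leRHS]mulrDr normcN !normcM normc_conj.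
  by rewrite lerD// ler_wpM2r ?normc_ge0.
have h1 : normc (phi j) <= seqnorm chi.
  by rewrite (le_trans _ (normc_le_seqnorm _ j))// chiE f0 ?lexx// subr0.
have h2 : normc (psi (j - 1)) <= seqnorm chi.
  rewrite (le_trans _ (normc_le_seqnorm _ (j - 1)))// chiE fE ?jj2//.
  by case: hphi => sup' _ _; rewrite sup'// sub0r normcN.
have h3 : normc z <= normc (psi (j - 1) + z) + normc (psi (j - 1)).
  by rewrite -[X in normc X <= _](addKr (psi (j - 1))) addrC; apply: le_normcB.
have h4 := normc_ge0 (psi j + phi j).
rewrite /C (_ : 2 * K * M = K * M + K * M); last by ring.
rewrite !mulrDl mul1r; lra.
Qed.

(** Otherwise every pair of data would come from a right solution, against
    [right_solutions_dependent]. *)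
Lemma exists_left_solution j : exists psi, left j psi /\
  (psi j != 0 \/ psi (j - 1) != 0).
Proof.
apply: contrapT => no.
have z psi : left j psi -> psi j = 0 /\ psi (j - 1) = 0.
  move=> hpsi; apply: contrapT => h; apply: no; exists psi; split=> //.
  have [h0|] := eqVneq (psi j) 0; last by left.
  by right; apply/eqP => h1; apply: h.
have [psi1 [phi1 [z1 [/z[-> ->] hphi1 e1 f1]]]] := left_right_decomposition j 1 0.
have [psi2 [phi2 [z2 [/z[-> ->] hphi2 e2 f2]]]] := left_right_decomposition j 0 1.
move: e1 f1 e2 f2 hphi1 hphi2; rewrite !add0r => e1 <- e2 <- h1 h2.
exact: (right_solutions_dependent h1 h2).
Qed.

Lemma exists_right_solution j : exists psi z, right j z psi /\
  (psi j != 0 \/ z != 0).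
Proof.
apply: contrapT => no.
have zz psi z : right j z psi -> psi j = 0 /\ z = 0.
  move=> hpsi; apply: contrapT => h; apply: no; exists psi, z; split=> //.
  have [h0|] := eqVneq (psi j) 0; last by left.
  by right; apply/eqP => h1; apply: h.
have [psi1 [phi1 [z1 [h1 /zz[-> ->]]]]] := left_right_decomposition j 1 0.
have [psi2 [phi2 [z2 [h2 /zz[-> ->]]]]] := left_right_decomposition j 0 1.
rewrite !addr0 => e2 f2 e1 f1.
by apply: (left_solutions_dependent h1 h2).
Qed.

End invertible_jacobi.

(** * The invariant bundles as sets of data of half-line solutions *)

Section solution_vectors.
Context {R : realType} (a : int -> R[i]) (b : int -> R).
Variable E : R[i].
Implicit Types (psi phi : l2 R) (j n : int) (v w : 'cV[R[i]]_2).

Let B := jacobi_cocycle a b E.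

(** The fibre of the unstable bundle, kept as a predicate until it is known to be a line;
    [right_vector] is the stable one. *)
Definition left_vector j v := exists psi,
  [/\ left_solution a b E j psi, v 0 0 = psi j & v 1 0 = psi (j - 1)].

Definition right_vector j v := exists psi,
  right_solution a b E j (v 1 0) psi /\ v 0 0 = psi j.

Lemma jacobi_eqn_linear k psi phi n :
  jacobi_eqn a b E (k *: psi + phi) n =
  k * jacobi_eqn a b E psi n + jacobi_eqn a b E phi n.
Proof. by rewrite /jacobi_eqn !l2_addE !l2_scaleE; ring. Qed.

Lemma left_vector_linear j k v w : left_vector j v -> left_vector j w ->
  left_vector j (k *: v + w).
Proof.
move=> [psi [[sup sol] v0 v1]] [phi [[sup' sol'] w0 w1]].
exists (k *: psi + phi); rewrite !mxE v0 v1 w0 w1; split=> //; split=> n nj.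
  by rewrite l2_addE l2_scaleE sup// sup'// mulr0 addr0.
by rewrite jacobi_eqn_linear sol// sol'// mulr0 addr0.
Qed.

Lemma right_vector_linear j k v w : right_vector j v -> right_vector j w ->
  right_vector j (k *: v + w).
Proof.
move=> [psi [[sup sol solj] v0]] [phi [[sup' sol' solj'] w0]].
exists (k *: psi + phi); rewrite !mxE v0 w0; split=> //; split=> [n nj|n nj|].
- by rewrite l2_addE l2_scaleE sup// sup'// mulr0 addr0.
- by rewrite jacobi_eqn_linear sol// sol'// mulr0 addr0.
- by rewrite jacobi_eqn_linear solj solj'; ring.
Qed.

Lemma left_vector_step j v : left_vector j v -> left_vector (j + 1) (B j *m v).
Proof.
move=> [psi [sol v0 v1]]; have [phi [sol' [e1 e]]] := left_solution_step sol.
exists phi; split=> //; first by rewrite jacobi_cocycle_mul0 v0 v1.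
by rewrite jacobi_cocycle_mul1 v0 addrK e.
Qed.

Lemma right_vector_step j v : right_vector j v -> right_vector (j + 1) (B j *m v).
Proof.
move=> [psi [sol v0]]; have [phi [sol' e]] := right_solution_step sol.
exists phi; rewrite jacobi_cocycle_mul1 v0; split=> //.
rewrite jacobi_cocycle_mul0 v0 (right_solution_next sol) e//; clear; lia.
Qed.

(** To the left of [j] the propagated solution is the old one times the product of the [a], so its
    decay from [j + m] back to [j] compares that product with the iterated cocycle. *)
Lemma left_vector_iter j v psi (m : nat) : left_solution a b E j psi ->
  v 0 0 = psi j -> v 1 0 = psi (j - 1) ->
  exists phi, [/\ left_solution a b E (j + m%:Z) phi,
    (iter_cocycle B m j *m v) 0 0 = phi (j + m%:Z),
    (iter_cocycle B m j *m v) 1 0 = phi (j + m%:Z - 1) &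
    forall n, n <= j -> phi n = (\prod_(i < m) a (j + i%:Z)) * psi n].
Proof.
move=> sol v0 v1; elim: m => [|m [phi [sol' w0 w1 phiE]]].
  exists psi; rewrite mul1mx addr0; split=> // n _.
  by rewrite big_ord0 mul1r.
have [chi [sol'' [e1 e]]] := left_solution_step sol'.
have jm : j + m.+1%:Z = j + m%:Z + 1 by clear; lia.
exists chi; rewrite jm addrK /= -mulmxA; split=> //.
- by rewrite jacobi_cocycle_mul0 w0 w1.
- by rewrite jacobi_cocycle_mul1 w0 e.
- move=> n nj; rewrite e; last by clear -nj; lia.
  by rewrite phiE// big_ord_recr/= mulrCA mulrA.
Qed.

(** At least one step is taken: with none, the second component is the free parameter and not a
    value of [psi]. *)
Lemma right_vector_iter j v psi (m : nat) : right_solution a b E j (v 1 0) psi ->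
  v 0 0 = psi j ->
  (iter_cocycle B m.+1 j *m v) 0 0 =
    (\prod_(i < m.+1) a (j + i%:Z)) * psi (j + m.+1%:Z) /\
  (iter_cocycle B m.+1 j *m v) 1 0 =
    (\prod_(i < m.+1) a (j + i%:Z)) * psi (j + m%:Z).
Proof.
move=> hpsi v0; elim: m => [|m [w0 w1]].
  rewrite /= mulmx1 addr0 big_ord1 addr0 jacobi_cocycle_mul0 jacobi_cocycle_mul1 v0.
  by rewrite (right_solution_next hpsi).
rewrite [iter_cocycle B m.+2 j]/(B (j + m.+1%:Z) *m iter_cocycle B m.+1 j) -mulmxA.
rewrite jacobi_cocycle_mul0 jacobi_cocycle_mul1 w0 w1 [\prod_(i < m.+2) _]big_ord_recr/=.
split; last by rewrite mulrCA mulrA.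
have [_ sol _] := hpsi; have := sol (j + m.+1%:Z).
have -> : j < j + m.+1%:Z by clear; lia.
move=> /(_ isT); rewrite /jacobi_eqn.
have -> : j + m.+1%:Z - 1 = j + m%:Z by clear; lia.
have -> : j + m.+1%:Z + 1 = j + m.+2%:Z by clear; lia.
move: (\prod_(i < m.+1) _) (psi _) (psi _) (psi _) => P x y z h.
apply/eqP; rewrite -subr_eq0; apply/eqP.
rewrite -[RHS](mulr0 (- P)) -h; ring.
Qed.

End solution_vectors.

(** * Expansion, domination and the splitting *)

Section resolvent_splitting.
Context {R : realType} (a : int -> R[i]) (b : int -> R).
Context (ha : bounded_fun (a : int -> R[i]^o)) (hb : bounded_fun (b : int -> R^o)).
Variables (E : R[i]) (K M : R).
Hypotheses (K0 : 0 < K) (M0 : 0 < M).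
Hypothesis (aM : forall n, normc (a n) <= M).
Hypothesis (bM : forall n, normc (E - (b n)%:C) <= M).
Hypothesis (TK : forall psi : l2 R,
  seqnorm psi <= K * seqnorm (jacobi ha hb psi - E *: psi)).
Hypothesis (Tsurj : forall g : l2 R, exists psi, jacobi ha hb psi - E *: psi = g).
Implicit Types (psi phi : l2 R) (j n : int) (u s v w : 'cV[R[i]]_2).

Let B := jacobi_cocycle a b E.
Let left_vec := left_vector a b E.
Let right_vec := right_vector a b E.

Lemma sqr_le_sqr (x y : R) : 0 <= x -> x <= y -> x ^+ 2 <= y ^+ 2.
Proof. by move=> x0 xy; rewrite ler_pXn2r ?nnegrE// (le_trans x0). Qed.

Lemma add_normc_le_enorm v : normc (v 0 0) + normc (v 1 0) <= 2 * enorm v.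
Proof. by rewrite mulr_natl mulr2n lerD// normc_le_enorm. Qed.

Lemma left_vector_expand j v : left_vec j v -> enorm v <= 4 * K * enorm (B j *m v).
Proof.
move=> [psi [sol v0 v1]].
have := left_solution_bound_step K0 TK sol.
rewrite -v0 -v1 -jacobi_cocycle_mul0 -(jacobi_cocycle_mul1 a b E) -/B => h.
have h2 := ler_wpM2l (ltW K0) (add_normc_le_enorm (B j *m v)).
have := enorm_le_add v; rewrite v0 v1.
have := normc_le_seqnorm psi j; have := normc_le_seqnorm psi (j - 1).
rewrite (_ : 4 * K * enorm (B j *m v) = 2 * (K * (2 * enorm (B j *m v)))); last by ring.
lra.
Qed.

Lemma left_right_vector_independent j u s : left_vec j u -> right_vec j s ->
  enorm s <= (2 * K * M + 1) * 2 * enorm (u + s).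
Proof.
move=> [psi [solu u0 u1]] [phi [sols s0]].
have := left_right_independent K0 aM TK solu sols.
rewrite -u0 -u1 -s0 => h; apply: (le_trans (enorm_le_add s)); apply: (le_trans h).
have KM0 : 0 <= 2 * K * M + 1 by rewrite addr_ge0 ?mulr_ge0 ?ltW.
rewrite -[leRHS]mulrA ler_wpM2l//.
by have := add_normc_le_enorm (u + s); rewrite ![(u + s) _ 0]mxE.
Qed.

Lemma exists_unit_left_vector j : exists u, left_vec j u /\ enorm u = 1.
Proof.
have [psi [sol nz]] := exists_left_solution K0 M0 aM TK Tsurj j.
pose v : 'cV[R[i]]_2 := \col_i (if i == 0 then psi j else psi (j - 1)).
have v0 : v 0 0 = psi j by rewrite mxE.
have v1 : v 1 0 = psi (j - 1) by rewrite mxE.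
have vnz : v != 0.
  apply/eqP => vz; move: v0 v1; rewrite vz !mxE => e0 e1.
  by case: nz; rewrite -?e0 -?e1 eqxx.
have ev : 0 < enorm v by exact: enorm_gt0.
have lv : left_vec j v by exists psi.
have l0 : left_vec j 0.
  by rewrite -(addNr v) -scaleN1r; exact: left_vector_linear.
exists ((enorm v)^-1%:C *: v + 0); split; first exact: left_vector_linear.
by rewrite addr0 enormZ normc_real ger0_norm ?invr_ge0 ?(ltW ev)// mulVf// gt_eqF.
Qed.

Lemma exists_unit_right_vector j : exists s, right_vec j s /\ enorm s = 1.
Proof.
have [psi [z [sol nz]]] := exists_right_solution K0 M0 aM TK Tsurj j.
pose v : 'cV[R[i]]_2 := \col_i (if i == 0 then psi j else z).
have v0 : v 0 0 = psi j by rewrite mxE.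
have v1 : v 1 0 = z by rewrite mxE.
have vnz : v != 0.
  apply/eqP => vz; move: v0 v1; rewrite vz !mxE => e0 e1.
  by case: nz; rewrite -?e0 -?e1 eqxx.
have ev : 0 < enorm v by exact: enorm_gt0.
have lv : right_vec j v by exists psi; rewrite v1.
have l0 : right_vec j 0.
  by rewrite -(addNr v) -scaleN1r; exact: right_vector_linear.
exists ((enorm v)^-1%:C *: v + 0); split; first exact: right_vector_linear.
by rewrite addr0 enormZ normc_real ger0_norm ?invr_ge0 ?(ltW ev)// mulVf// gt_eqF.
Qed.

(** The squared constant of the decay lemmas, with data bounded by twice their Euclidean norm and
    summed over two components. *)
Let G := 2 * (4 * (2 * K * M) ^+ 2) ^+ 2.

(** The product of the [a] is an upper bound here and a lower bound in [left_vector_decay]; it drops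
    out when the two are combined. *)
Lemma right_vector_decay j s (m : nat) : right_vec j s ->
  m%:R * enorm (iter_cocycle B m.+1 j *m s) ^+ 2 <=
  G * normc (\prod_(i < m.+1) a (j + i%:Z)) ^+ 2 * enorm s ^+ 2.
Proof.
move=> [psi [sol s0]]; have [w0 w1] := right_vector_iter m sol s0.
rewrite enorm_sqr w0 w1; set P := \prod_(i < _) _.
have d1 := right_solution_decay K0 M0 aM TK m.+1 sol.
have d0 := right_solution_decay K0 M0 aM TK m sol.
have X0 : 2 * (2 * K * M) ^+ 2 * (normc (psi j) + normc (s 1 0)) <=
          4 * (2 * K * M) ^+ 2 * enorm s.
  rewrite (_ : 4 * _ * _ = 2 * (2 * K * M) ^+ 2 * (2 * enorm s)); last by ring.
  by apply: ler_wpM2l; [rewrite mulr_ge0 ?sqr_ge0|rewrite -s0 add_normc_le_enorm].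
have X2 : (2 * (2 * K * M) ^+ 2 * (normc (psi j) + normc (s 1 0))) ^+ 2 <=
          (4 * (2 * K * M) ^+ 2 * enorm s) ^+ 2.
  apply: sqr_le_sqr X0; apply: mulr_ge0; last by rewrite addr_ge0 ?normc_ge0.
  by rewrite mulr_ge0 ?sqr_ge0.
have d1' : m%:R * normc (psi (j + m.+1%:Z)) ^+ 2 <=
    m.+1%:R * normc (psi (j + m.+1%:Z)) ^+ 2.
  by rewrite ler_wpM2r ?sqr_ge0// ler_nat.
rewrite !normcM !exprMn -mulrDr mulrCA /G.
rewrite (_ : _ * _ * _ * enorm s ^+ 2 = normc P ^+ 2 *
  ((4 * (2 * K * M) ^+ 2 * enorm s) ^+ 2 + (4 * (2 * K * M) ^+ 2 * enorm s) ^+ 2)); last by ring.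
rewrite ler_wpM2l ?sqr_ge0// mulrDr; apply: lerD.
  exact: le_trans d1' (le_trans d1 X2).
exact: le_trans d0 X2.
Qed.

Lemma left_vector_decay j u (m : nat) : left_vec j u ->
  m%:R * (normc (\prod_(i < m) a (j + i%:Z)) ^+ 2 * enorm u ^+ 2) <=
  G * enorm (iter_cocycle B m j *m u) ^+ 2.
Proof.
move=> [psi [sol u0 u1]]; have [phi [sol' w0 w1 phiE]] := left_vector_iter m sol u0 u1.
have d0 := left_solution_decay K0 M0 aM bM TK m sol'.
(* The site [j - 1] lies [m + 1] steps to the left of the new end point [j + m]. *)
have d1 := left_solution_decay K0 M0 aM bM TK m.+1 sol'.
move: d0 d1; rewrite -w0 -w1 -/B; set w := iter_cocycle B m j *m u.
set P := \prod_(i < m) _ in phiE *.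
have -> : phi (j + m%:Z - m%:Z) = P * psi j by rewrite addrK phiE.
have -> : phi (j + m%:Z - m.+1%:Z) = P * psi (j - 1).
  have -> : j + m%:Z - m.+1%:Z = j - 1 by clear; lia.
  by rewrite phiE//; clear; lia.
move=> d0 d1.
have X0 : 2 * (2 * K * M) ^+ 2 * (normc (w 0 0) + normc (w 1 0)) <=
          4 * (2 * K * M) ^+ 2 * enorm w.
  rewrite (_ : 4 * _ * _ = 2 * (2 * K * M) ^+ 2 * (2 * enorm w)); last by ring.
  by apply: ler_wpM2l; [rewrite mulr_ge0 ?sqr_ge0|exact: add_normc_le_enorm].
have X2 : (2 * (2 * K * M) ^+ 2 * (normc (w 0 0) + normc (w 1 0))) ^+ 2 <=
          (4 * (2 * K * M) ^+ 2 * enorm w) ^+ 2.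
  apply: sqr_le_sqr X0; apply: mulr_ge0; last by rewrite addr_ge0 ?normc_ge0.
  by rewrite mulr_ge0 ?sqr_ge0.
have d1' : m%:R * normc (P * psi (j - 1)) ^+ 2 <=
    m.+1%:R * normc (P * psi (j - 1)) ^+ 2.
  by rewrite ler_wpM2r ?sqr_ge0// ler_nat.
rewrite enorm_sqr u0 u1 mulrDr -!exprMn -!normcM mulrDr /G.
rewrite (_ : 2 * _ * enorm w ^+ 2 =
  (4 * (2 * K * M) ^+ 2 * enorm w) ^+ 2 + (4 * (2 * K * M) ^+ 2 * enorm w) ^+ 2); last by ring.
by apply: lerD; [exact: le_trans d0 X2|exact: le_trans d1' (le_trans d1 X2)].
Qed.

Lemma exists_domination : exists2 N : nat, (0 < N)%N &
  forall j u s, left_vec j u -> right_vec j s -> enorm u = 1 -> enorm s = 1 ->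
    0 < enorm (iter_cocycle B N j *m u) ->
    2 * enorm (iter_cocycle B N j *m s) < enorm (iter_cocycle B N j *m u).
Proof.
have G0 : 0 < G by rewrite mulr_gt0// exprn_gt0// mulr_gt0// exprn_gt0// !mulr_gt0.
(* Each decay estimate then gains a factor 3 in squares, so the squared norms differ by a factor 9,
   more than the required 4; strictness comes from positivity of the larger norm. *)
pose m := (Num.truncn (3 * G)).+1.
have mG : 3 * G <= m%:R by apply: ltW; exact: truncnS_gt.
exists m.+1 => // j u s lu rs u1 s1 wu0.
have hs := right_vector_decay m rs; have hu := left_vector_decay m.+1 lu.
move: hs hu; rewrite u1 s1 expr1n !mulr1.
move: (normc_ge0 (\prod_(i < m.+1) a (j + i%:Z))) (enorm_ge0 (iter_cocycle B m.+1 j *m s)) wu0.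
move: (enorm _) (enorm _) (normc _) => x y p p0 y0 x0 hs hu.
have hs3 : 3 * y ^+ 2 <= p ^+ 2.
  rewrite -(ler_pM2l G0) (le_trans _ hs)// mulrA [G * 3]mulrC ler_wpM2r ?sqr_ge0//.
have hu3 : 3 * p ^+ 2 <= x ^+ 2.
  rewrite -(ler_pM2l G0) (le_trans _ hu)// mulrA [G * 3]mulrC ler_wpM2r ?sqr_ge0//.
  by rewrite (le_trans mG)// ler_nat.
rewrite -(ltr_pXn2r (_ : 0 < 2)%N) ?nnegrE ?mulr_ge0 ?(ltW x0)// exprMn.
have := exprn_gt0 2 x0; have := sqr_ge0 y; lra.
Qed.

Lemma jacobi_cocycle_bounded : bounded_fun (B : int -> 'M[R[i]]_2).
Proof.
exists (M%:C); split; first by rewrite complex_real.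
move=> x Mx j _ /=; apply: le_trans (ltW Mx).
change (mx_norm (B j) <= M%:C).
have [->|/mx_norm_neq0[[i k] /= ->]] := eqVneq (mx_norm (B j)) 0.
  by rewrite lecR ltW.
rewrite -[`|_|]/((normc (B j i k))%:C) lecR.
rewrite mxE; case: ifP => _; case: ifP => _; first exact: bM.
- by rewrite normcN normc_conj.
- exact: aM.
- by rewrite normc0 ltW.
Qed.

Lemma invertible_dominated_splitting : dominated_splitting B.
Proof.
split; first exact: jacobi_cocycle_bounded.
have /choice[u hu] := exists_unit_left_vector.
have /choice[s hs] := exists_unit_right_vector.
have lu j : left_vec j (u j) by case: (hu j).
have rs j : right_vec j (s j) by case: (hs j).
have u1 j : enorm (u j) = 1 by case: (hu j).
have s1 j : enorm (s j) = 1 by case: (hs j).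
have n0 v : enorm v = 1 -> v != 0.
  move=> v1; apply/eqP => v0; have := enormZ 0 v.
  by rewrite scale0r v0 -v0 v1 normc0 mul0r => /eqP; rewrite oner_eq0.
pose C := (2 * K * M + 1) * 2.
have C0 : 0 < C by rewrite mulr_gt0// addr_gt0// !mulr_gt0.
pose D j := u j 0 0 * s j 1 0 - u j 1 0 * s j 0 0.
have lin0 j v : left_vec j v -> left_vec j 0.
  by move=> lv; rewrite -(addNr v) -scaleN1r; exact: left_vector_linear.
have rin0 j v : right_vec j v -> right_vec j 0.
  by move=> lv; rewrite -(addNr v) -scaleN1r; exact: right_vector_linear.
have lZ j k v : left_vec j v -> left_vec j (k *: v).
  by move=> lv; rewrite -[k *: v]addr0; apply: left_vector_linear => //; exact: lin0 lv.
have rZ j k v : right_vec j v -> right_vec j (k *: v).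
  by move=> lv; rewrite -[k *: v]addr0; apply: right_vector_linear => //; exact: rin0 lv.
(* Removing from [s j] its projection on [u j] leaves [D j] times a unit vector orthogonal to [u j],
   so independence of left and right vectors bounds [D j] from below. *)
have DC j : C^-1 <= normc (D j).
  have uu : (u j 0 0)^* * u j 0 0 + (u j 1 0)^* * u j 1 0 = 1.
    rewrite ![_^* * _]mulrC -!normc_sqr -rmorphD -enorm_sqr u1 expr1n.
    by [].
  pose k := (u j 0 0)^* * s j 0 0 + (u j 1 0)^* * s j 1 0.
  have e : - k *: u j + s j = \col_i (if i == 0 then - (u j 1 0)^* * D j else (u j 0 0)^* * D j).
    apply: cV2_eqP; rewrite !mxE /= /k /D.
      rewrite -[X in _ + X]mul1r -uu; ring.
    by rewrite -[X in _ + X]mul1r -uu; ring.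
  have := left_right_vector_independent (lZ j (- k) _ (lu j)) (rs j).
  rewrite s1 -/C; have -> : enorm (- k *: u j + s j) = normc (D j).
    apply/eqP; rewrite -(eqrXn2 (_ : 0 < 2)%N) ?enorm_ge0 ?normc_ge0// enorm_sqr e !mxE /=.
    rewrite !normcM normcN !normc_conj !exprMn -mulrDl addrC -enorm_sqr u1 expr1n mul1r.
    by [].
  by rewrite -ler_pdivrMl// mulr1.
have D0 j : D j != 0 by rewrite -normc_gt0 (lt_le_trans _ (DC j))// invr_gt0.
(* The component of a left vector along [s j] is also a left vector, and by independence it
   vanishes. *)
have lineL j v : left_vec j v -> exists k, v = k *: u j.
  move=> lv; have vE := det_decomposition v (D0 j).
  move: vE; set x := _ / _; set y := _ / _ => vE.
  have ly : left_vec j (-1 *: v + x *: u j) by apply: left_vector_linear => //; exact: lZ.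
  have := left_right_vector_independent ly (rZ j y _ (rs j)).
  rewrite -addrA -vE scaleN1r addNr.
  have -> : enorm (0 : 'cV[R[i]]_2) = 0.
    by have := enormZ 0 (0 : 'cV[R[i]]_2); rewrite scaler0 normc0 mul0r.
  rewrite mulr0 enormZ s1 mulr1 => y0.
  have yz : y = 0 by apply: eq0_normc; apply/eqP; rewrite eq_le y0 normc_ge0.
  by exists x; rewrite vE yz scale0r addr0.
have lineR j v : right_vec j v -> exists k, v = k *: s j.
  move=> rv; have vE := det_decomposition v (D0 j).
  move: vE; set x := _ / _; set y := _ / _ => vE.
  have ry : right_vec j (- y *: s j + v) by exact: right_vector_linear (rs j) rv.
  have := left_right_vector_independent (lZ j (- x) _ (lu j)) ry.
  have e : - y *: s j + v = x *: u j by rewrite vE addrCA scaleNr addNr addr0.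
  rewrite e scaleNr addNr.
  have -> : enorm (0 : 'cV[R[i]]_2) = 0.
    by have := enormZ 0 (0 : 'cV[R[i]]_2); rewrite scaler0 normc0 mul0r.
  rewrite mulr0 enormZ u1 mulr1 => y0.
  have xz : x = 0 by apply: eq0_normc; apply/eqP; rewrite eq_le y0 normc_ge0.
  by exists y; rewrite vE xz scale0r add0r.
have [N N0 dom] := exists_domination.
(* This lower bound gives both the positivity required by [exists_domination] and the bound on the
   infimum. *)
have expand j (m : nat) v : left_vec j v ->
    left_vec (j + m%:Z) (iter_cocycle B m j *m v) /\
    enorm v <= (4 * K) ^+ m * enorm (iter_cocycle B m j *m v).
  move=> lv; elim: m => [|m [lm em]]; first by rewrite addr0 mul1mx expr0 mul1r.
  rewrite /= -mulmxA (_ : j + m.+1%:Z = j + m%:Z + 1); last by clear; lia.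
  split; first exact: left_vector_step.
  apply: (le_trans em); rewrite exprSr -mulrA ler_wpM2l ?exprn_ge0 ?mulr_ge0 ?(ltW K0)//.
  exact: left_vector_expand.
have K4 : 0 < (4 * K) ^+ N by rewrite exprn_gt0// mulr_gt0.
have low j v : left_vec j v -> enorm v = 1 ->
    ((4 * K) ^+ N)^-1 <= enorm (iter_cocycle B N j *m v).
  by move=> lv v1; have [_] := expand j N v lv; rewrite v1 -ler_pdivrMl// mulr1.
exists (fun j => <[u j]>%VS), (fun j => <[s j]>%VS); split.
  by move=> j; rewrite !dim_vline !n0.
(* The distance of the lines is twice a determinant of modulus at least [C^-1], hence strictly
   larger than [C^-1]. *)
exists N, 2, C^-1; split; first by rewrite invr_gt0 ltr1n.
split.
- move=> j; split=> v /vlineP[k ->]; rewrite -scalemxAr memvZ//; apply/vlineP.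
    exact: (lineL _ _ (left_vector_step (lu j))).
  exact: (lineR _ _ (right_vector_step (rs j))).
- move=> j v w /vlineP[k ->] /vlineP[l ->] v1 w1.
  apply: dom => //; [exact: lZ|exact: rZ|].
  by apply: (lt_le_trans _ (low j _ (lZ _ _ _ (lu j)) v1)); rewrite invr_gt0.
- move=> j; rewrite (line_distE _ _ (memv_line (u j)) (n0 _ (u1 j))
    (memv_line (s j)) (n0 _ (s1 j))) ?dim_vline ?n0//.
  rewrite /vec_dist u1 s1 mulr1 divr1 det_row_cV2 -/(D j).
  have := DC j; have : 0 < C^-1 by rewrite invr_gt0.
  lra.
- apply: (@lt_le_trans _ _ ((4 * K) ^+ N)^-1); first by rewrite invr_gt0.
  apply: lb_le_inf; first by exists (opnorm (iter_cocycle B N 0)), 0.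
  move=> _ [j _ <-]; apply: (le_trans (low j _ (lu j) (u1 j))).
  have [L L0 BL] := jacobi_cocycle_bound ha hb E.
  have BN m v : enorm (iter_cocycle B m j *m v) <= L ^+ m * enorm v.
    elim: m => [|m IH]; first by rewrite mul1mx expr0 mul1r.
    by rewrite /= -mulmxA (le_trans (BL _ _))// exprS -mulrA ler_wpM2l// ltW.
  (* The supremum dominates the value at [u j] once the set is bounded above. *)
  have ubE : has_ubound [set enorm (iter_cocycle B N j *m v) | v in [set v | enorm v = 1]].
    by exists (L ^+ N) => _ [z z1 <-]; rewrite (le_trans (BN _ _))// z1 mulr1.
  by apply: (ub_le_sup ubE); exists (u j).
Qed.

End resolvent_splitting.

Theorem theorem4 (R : realType) (a : int -> R[i]) (b : int -> R)
    (ha : bounded_fun (a : int -> R[i]^o)) (hb : bounded_fun (b : int -> R^o)) :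
  resolvent_set (jacobi ha hb) =
  [set E : R[i] | dominated_splitting (jacobi_cocycle a b E)].
Proof.
apply/seteqP; split => E /= hE; last first.
  by move=> /(_ (dominated_splitting_resolvent ha hb hE)).
have /boundedly_invertible_elim[[K K0 TK] Tsurj] :
    boundedly_invertible (fun v => jacobi ha hb v - E *: v) by exact: contrapT.
have [Ma hMa] := bounded_normc ha.
have [Mb hMb] := bounded_norm hb.
have Ma0 : 0 <= Ma by rewrite (le_trans _ (hMa 0))// normc_ge0.
have Mb0 : 0 <= Mb by rewrite (le_trans _ (hMb 0)).
have E0 := normc_ge0 E.
(* A common bound for [a] and [E - b]; the summand 1 makes it positive. *)
apply: (@invertible_dominated_splitting _ a b ha hb E K (normc E + Mb + Ma + 1)) => //.
- lra.
- by move=> n; have := hMa n; lra.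
- move=> n; apply: (le_trans (le_normcB _ _)); rewrite normc_real.
  by have := hMb n; lra.
Qed.
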